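(* There exists a constant $C$ such that for all $w\in A_2^d$ and all $b\in BMO^d$, $$\|\pi_b^*S\|_{L^2(w)\to L^2(w)}+\|S\pi_b\|_{L^2(w)\to L^2(w)}\le C\,[w]_{A_2^d}\,\|b\|_{BMO^d}.$$
   Context: $\mathcal{D}$ is the collection of dyadic intervals $[k2^{-j},(k+1)2^{-j})$, $j,k\in\mathbb{Z}$, of $\mathbb{R}$. For $I\in\mathcal{D}$, $I_-$ and $I_+$ are its left and right halves, $h_I=|I|^{-1/2}(\chi_{I_+}-\chi_{I_-})$, $\langle f\rangle_I=\frac{1}{|I|}\int_I f$, and $\langle f,g\rangle=\int_{\mathbb{R}}fg\,dx$. A weight is a locally integrable, a.e. positive function $w$ on $\mathbb{R}$; $\|f\|_{L^2(w)}^2=\int|f|^2w\,dx$; $w\in A_2^d$ means $[w]_{A_2^d}:=\sup_{I\in\mathcal{D}}\langle w\rangle_I\langle w^{-1}\rangle_I<\infty$. $BMO^d$ is the space of locally integrable $b$ with $\|b\|_{BMO^d}:=\sup_{I\in\mathcal{D}}\frac1{|I|}\int_I|b-\langle b\rangle_I|\,dx<\infty$. The dyadic shift operator is $Sf=\sum_{I\in\mathcal{D}}\langle f,h_I\rangle(h_{I_-}-h_{I_+})$; the dyadic paraproduct is $\pi_bf=\sum_{I\in\mathcal{D}}\langle b,h_I\rangle\langle f\rangle_Ih_I$, and its adjoint is $\pi_b^*f=\sum_{I\in\mathcal{D}}\langle b,h_I\rangle\langle f,h_I\rangle h_I^2$. All three are bounded on unweighted $L^2(\mathbb{R})$; the compositions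 are defined on $L^2\cap L^2(w)$ and extended to $L^2(w)$ by boundedness. *)

(* Defs.v *)
From HB Require Import structures.
From mathcomp Require Import all_boot all_order all_algebra finmap.
From mathcomp Require Import all_classical all_reals all_analysis.
Set Implicit Arguments.
Unset Strict Implicit.
Unset Printing Implicit Defensive.
Import Order.TTheory GRing.Theory Num.Theory.
Import numFieldNormedType.Exports.
Local Open Scope classical_set_scope.
Local Open Scope ring_scope.

(* Functions on the line are Borel measurable throughout; every Lebesgue
   measurable function agrees a.e. with a Borel one. *)

(* The pair (j, k) stands for [k 2^-j, (k+1) 2^-j); distinct pairs give
   distinct intervals. *)
Definition dyadic : Type := (int * int)%type.

Section DyadicOperators.
Variable R : realType.
Local Notation mu := (@lebesgue_measure R).
Implicit Types (I : dyadic) (w b f g : R -> R).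

Definition dyadic_len I : R := (2 : R) ^ (- I.1).

Definition dyadic_set I : set R :=
  `[I.2%:~R * dyadic_len I, (I.2 + 1)%:~R * dyadic_len I[.

Definition left_half I : dyadic := (I.1 + 1, 2 * I.2).
Definition right_half I : dyadic := (I.1 + 1, 2 * I.2 + 1).

Definition haar I (x : R) : R :=
  (Num.sqrt (dyadic_len I))^-1 *
  (\1_(dyadic_set (right_half I)) x - \1_(dyadic_set (left_half I)) x).

Definition inner f g : R := \int[mu]_x (f x * g x).

Definition avg f I : R := (dyadic_len I)^-1 * \int[mu]_(x in dyadic_set I) f x.

(* Extended-real average, so that a non-integrable integrand counts as +oo. *)
Definition eavg f I : \bar R :=
  (((dyadic_len I)^-1)%:E * \int[mu]_(x in dyadic_set I) (f x)%:E)%E.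

Definition weight w : Prop :=
  locally_integrable setT w /\ {ae mu, forall x, 0 < w x}.

Definition A2d_char w : \bar R :=
  ereal_sup (range (fun I => (eavg w I * eavg (fun x => (w x)^-1)%R I)%E)).

Definition A2d w : Prop := weight w /\ (A2d_char w < +oo)%E.

Definition BMOd_norm b : \bar R :=
  ereal_sup (range (fun I => eavg (fun x => `|b x - avg b I|) I)).

Definition BMOd b : Prop :=
  locally_integrable setT b /\ (BMOd_norm b < +oo)%E.

Definition wnorm w f : \bar R :=
  ((\int[mu]_x (`|f x| ^+ 2 * w x)%:E) `^ 2^-1)%E.

(* g is the sum in L^2(R) of the family c, in the sense of unconditional
   convergence: the limit of the partial sums along the finite subsets of D. *)
Definition L2_sum (c : dyadic -> R -> R) g : Prop :=
  (g : measurableTypeR R -> R) \in Lfun mu 2%:E /\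
  forall e : R, 0 < e -> exists F0 : {fset dyadic}, forall F : {fset dyadic},
    (F0 `<=` F)%fset ->
    ('N[mu]_2%:E[EFin \o (fun x => g x - \sum_(I <- F) c I x)%R] < e%:E)%E.

(* A representative of the L^2 sum, which is unique up to a.e. equality. Each
   series below converges for f in L^2(R) and b in BMO^d; the value 0 is only
   a default for families with no sum. *)
Definition L2_series (c : dyadic -> R -> R) : R -> R :=
  xget (fun=> 0) [set g | L2_sum c g].

Definition dyadic_shift f : R -> R :=
  L2_series (fun I x =>
    inner f (haar I) * (haar (left_half I) x - haar (right_half I) x)).

Definition paraproduct b f : R -> R :=
  L2_series (fun I x => inner b (haar I) * avg f I * haar I x).

Definition paraproduct_adj b f : R -> R :=
  L2_series (fun I x => inner b (haar I) * inner f (haar I) * haar I x ^+ 2).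

(* Norm on L^2(w) of the operator T with domain the dense subspace
   L^2(R) /\ L^2(w); it is also the norm of the extension of T to L^2(w) by
   boundedness. *)
Definition wopnorm w (T : (R -> R) -> R -> R) : \bar R :=
  ereal_sup [set wnorm w (T f) | f in
    [set f | (f : measurableTypeR R -> R) \in Lfun mu 2%:E /\
             (wnorm w f <= 1)%E]].

End DyadicOperators.

(* Main.v *)
(* Both operators are dominated, term by term in the Haar expansion and after
   pairing with a test function, by the positive form
     sum_I |I| <|f|>_I (|D_I b| + |D_I- b| + |D_I+ b|) (|D_I g| + |D_I- g| + |D_I+ g|),
   D_I x = (<x>_I+ - <x>_I-)/2, so no cancellation is used and the two
   compositions can be treated together. On a finite dyadic tree the form is at
   most C [w]_{A_2} ||b|| (<f^2 w> + <g^2/w>), by one induction on the depth which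
   carries three things at once: a stopping time for the averages of |f|, |g| and
   |b - <b>_Q| (which replaces John-Nirenberg and sparse domination), the energies
   of b and g below the current stopping interval Q, and the running maxima of
   <|f|>_I/<1/w>_I and <|g|>_I/<w>_I, controlled by Doob's inequality. The rest is
   duality against bounded test functions. The default value 0 of a series
   without sum only makes the operators smaller, so convergence is not needed. *)
Require Import Defs.
From mathcomp Require Import all_boot all_order all_algebra finmap.
From mathcomp Require Import all_classical all_reals all_analysis.
From mathcomp Require Import measurable_realfun ring lra.
Set Implicit Arguments.
Unset Strict Implicit.
Unset Printing Implicit Defensive.
Import Order.TTheory GRing.Theory Num.Theory.
Import numFieldNormedType.Exports.
Local Open Scope classical_set_scope.
Local Open Scope ring_scope.

(** * Martingales on finite dyadic trees *)

Section Tree.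
Variable R : realFieldType.
Implicit Types (I J K : dyadic) (x : dyadic -> R).

(** Bounding [S] and [pi_b] one after the other would cost [[w]_{A_2}] twice. Here it is paid once,
    at the start of a stopping interval, where [p <= X * v], [q <= Y * u] and [u * v <= A] give
    [p * q <= A * (X * Y)]. Passing from [X * Y] to the Doob energies then uses only [1 <= u * v],
    and Doob's inequality relative to [1/w] and to [w] has a constant that does not see the weight.
    The norm of [b] enters only through the stopping rule: while the mean oscillation of [b] about
    its value at the top stays below a multiple of [B], its square function below that top is under
    control, and likewise for [g] and [Q]. Cauchy-Schwarz between these two energies is then enough.
    The level starts at 3 or less and stops above 6, so the next stopping intervals fill at most
    half of the current one; this replaces the Carleson packing condition. The result is a
    potential-function argument: [doob_sum - reserve] dominates the remaining sum, and only its
    behaviour from an interval to its halves has to be checked. *)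

Definition martingale x := forall K, x K = (x (left_half K) + x (right_half K)) / 2.

Definition incr x K : R := (x (right_half K) - x (left_half K)) / 2.

(** In [S pi_b] the increment of [b] sits at [K] and that of the test function at a half; in
    [pi_b^* S] the half carries [b] and [K] carries [f]. The symmetric sum covers both cases. *)
Definition incr3 x K : R :=
  `|incr x K| + `|incr x (left_half K)| + `|incr x (right_half K)|.

(** Each descendant is weighted by its length relative to [K]; [n] counts generations, that of [K]
    included. *)
Fixpoint tree_sum (t : dyadic -> R) n K : R :=
  if n is n'.+1
  then t K + (tree_sum t n' (left_half K) + tree_sum t n' (right_half K)) / 2
  else 0.

(** Two consecutive generations are taken together so that the mean gain from [K] to its halves sees
    the increments at [K] and at both halves, as [incr3] requires. *)
Definition energy (a : R) x K : R :=
  (x K - a) ^+ 2 + ((x (left_half K) - a) ^+ 2 + (x (right_half K) - a) ^+ 2) / 2.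

Lemma energy_ge0 a x K : 0 <= energy a x K.
Proof.
rewrite /energy; have := sqr_ge0 (x K - a); have := sqr_ge0 (x (left_half K) - a).
by have := sqr_ge0 (x (right_half K) - a); lra.
Qed.

(** The gain telescopes to [D_K^2 + (D_l^2 + D_r^2) / 2], with [D] the increments at [K] and its
    halves. The constant 6 is the 3 from the square of a sum of three terms times 2 for the weight
    1/2 of the halves. *)
Lemma energy_avg a x K : martingale x ->
  incr3 x K ^+ 2 <= 6 *
    ((energy a x (left_half K) + energy a x (right_half K)) / 2 - energy a x K).
Proof.
move=> mx; rewrite /energy /incr3.
have E : forall r s t : R, (`|r| + `|s| + `|t|) ^+ 2 <= 3 * (r ^+ 2 + s ^+ 2 + t ^+ 2).
  move=> r s t; rewrite -(real_normK (num_real r)) -(real_normK (num_real s)).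
  rewrite -(real_normK (num_real t)).
  move: (`|r|) (`|s|) (`|t|) => {}r {}s {}t.
  have := sqr_ge0 (r - s); have := sqr_ge0 (r - t); have := sqr_ge0 (s - t).
  by nra.
apply: (le_trans (E _ _ _)); rewrite /incr.
have := mx K; have := mx (left_half K); have := mx (right_half K).
set l := x (left_half K); set r := x (right_half K).
move: (x K) l r => k l r -> -> ->.
move: (x _) (x _) (x _) (x _) => p q s t.
have := sqr_ge0 (q - p); have := sqr_ge0 (s - t).
by have := sqr_ge0 (p + q - s - t); nra.
Qed.

Lemma nneg_kids x K : martingale x -> (forall J, 0 <= x J) ->
  x (left_half K) <= 2 * x K /\ x (right_half K) <= 2 * x K.
Proof.
move=> mx x0; have := mx K; have := x0 (left_half K); have := x0 (right_half K).
by lra.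
Qed.

(** A nonnegative martingale at most doubles from [K] to a half, whence [12 ^ 2 + 24 ^ 2 = 720]. *)
Lemma energy_bound a x (y : dyadic -> R) c K :
  martingale y -> (forall J, `|x J - a| <= y J) -> y K <= 12 * c ->
  energy a x K <= 720 * c ^+ 2.
Proof.
move=> my xy yc; have y0 J : 0 <= y J by apply: le_trans (xy J).
have [ly ry] := nneg_kids K my y0.
have S J e : y J <= e -> (x J - a) ^+ 2 <= e ^+ 2.
  move=> ye; rewrite -(real_normK (num_real (x J - a))).
  by rewrite ler_sqr ?nnegrE ?(le_trans (xy J)) // (le_trans (y0 J)).
have := S _ _ yc; have := S (left_half K) (24 * c) ltac:(lra).
have := S (right_half K) (24 * c) ltac:(lra).
by rewrite /energy; nra.
Qed.

(** * The weighted Carleson form on a finite tree *)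

Section CarlesonForm.
Variables (p F v q G u g b : dyadic -> R) (d : R -> dyadic -> R) (A B C : R).
Hypotheses (mp : martingale p) (mF : martingale F) (mv : martingale v).
Hypotheses (mq : martingale q) (mG : martingale G) (mu : martingale u).
Hypotheses (mg : martingale g) (mb : martingale b).
Hypothesis md : forall a, martingale (d a).
Hypotheses (p0 : forall K, 0 <= p K) (gq : forall K, `|g K| <= q K).
Hypotheses (v0 : forall K, 0 < v K) (u0 : forall K, 0 < u K).
Hypotheses (pF : forall K, p K ^+ 2 <= F K * v K).
Hypotheses (qG : forall K, q K ^+ 2 <= G K * u K).
Hypotheses (uv1 : forall K, 1 <= u K * v K) (uvA : forall K, u K * v K <= A).
Hypotheses (bd : forall a K, `|b K - a| <= d a K).
Hypotheses (dB : forall K, d (b K) K <= B) (B0 : 0 < B) (C1 : 18 * 1440 <= C).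

(** The sequences stand for dyadic averages: [p], [F], [v] of [|f|], [f^2 w], [1/w]; [q], [G], [u]
    of [|g|], [g^2 / w], [w]; and [d a] of [|b - a|]. *)
Definition carleson_term K : R := p K * incr3 b K * incr3 g K.

Lemma carleson_q_ge0 K : 0 <= q K. Proof. exact: le_trans (gq K). Qed.

Lemma carleson_d_ge0 a K : 0 <= d a K. Proof. exact: le_trans (bd a K). Qed.

(** The stopping level divides by [P] and [Q], so no stopping interval can start where [p] or [q]
    vanishes. A nonnegative martingale that vanishes at [K] vanishes at all descendants, so nothing
    remains to be estimated there. *)
Lemma tree_sum_eq0 n K : p K = 0 \/ q K = 0 -> tree_sum carleson_term n K = 0.
Proof.
elim: n K => [//|n IH] K pq /=.
have z x : (forall J, 0 <= x J) -> martingale x -> forall J, x J = 0 ->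
    x (left_half J) = 0 /\ x (right_half J) = 0.
  move=> x0 mx J; rewrite mx; have := x0 (left_half J); have := x0 (right_half J).
  by move=> *; split; lra.
have zp := z p p0 mp; have zq := z q carleson_q_ge0 mq.
rewrite !IH; last 2 first.
- by case: pq => [/zp[]|/zq[]]; [left|right].
- by case: pq => [/zp[]|/zq[]]; [left|right].
rewrite addr0 mul0r addr0 /carleson_term.
case: pq => [->|qK]; first by rewrite !mul0r.
have zg J : q J = 0 -> g J = 0.
  by move=> qJ; have := gq J; rewrite qJ normr_le0 => /eqP.
have [ql qr] := zq _ qK; have [qll qlr] := zq _ ql; have [qrl qrr] := zq _ qr.
by rewrite /incr3 /incr !zg // subrr mul0r normr0 !addr0 mulr0.
Qed.

(* [P], [Q], [a] are the averages of [p], [q], [b] at the current stopping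
   interval; the stopping rule is [6 < stop_level], and [stop_level <= 3] there. *)
Definition stop_level P Q a K : R := p K / P + q K / Q + d a K / B.

Definition local_energy Q a K : R := energy a b K / B ^+ 2 + energy 0 g K / Q ^+ 2.

(* The induction invariant. [X] and [Y] are the running maxima of [p / v] and
   [q / u]. The first term pays for future stopping intervals, a fraction at most
   [stop_level / 6] of [K] because [stop_level] is a martingale; the second is the
   part of the local energy budget that is still unspent: below a stopping
   interval [local_energy] never exceeds [1440], whence [18 * 1440 <= C]. *)
Definition reserve P Q a X Y K : R :=
  2 * C * A * B * (X * Y) * (1 - stop_level P Q a K / 6)
  - B * (P * Q) * (C - 18 * local_energy Q a K).

(* For fixed [X] this is a martingale in [(f, F', v')], it decreases when [X] is
   raised to [f / v'], and it dominates [X ^+ 2 * v']. *)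
Definition doob (f F' v' X : R) : R := 4 * F' - 4 * f * X + 2 * X ^+ 2 * v'.

Definition doob_sum X Y K : R :=
  C * A * B * (doob (p K) (F K) (v K) X + doob (q K) (G K) (u K) Y).

(** After multiplication by [v'] the difference of the two sides is at least
    [(2 * f - X * v') ^+ 2]. *)
Lemma doob_ge (f F' v' X : R) : 0 < v' -> f ^+ 2 <= F' * v' ->
  X ^+ 2 * v' <= doob f F' v' X.
Proof.
move=> v'0 fF; rewrite /doob -(ler_pM2r v'0).
by have := sqr_ge0 (2 * f - X * v'); nra.
Qed.

(** Raising [X] to [y = f / v'] lowers [doob] by exactly [2 * (y - X) ^+ 2 * v']. *)
Lemma doob_max (f F' v' X : R) : 0 < v' -> f <= Num.max X (f / v') * v' /\
  doob f F' v' (Num.max X (f / v')) <= doob f F' v' X.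
Proof.
move=> v'0; have [h|h] := leP (f / v') X.
  by split=> //; rewrite -ler_pdivrMr.
have E : f / v' * v' = f by rewrite divfK ?gt_eqF.
split; first by rewrite E.
rewrite /doob; move: h E; move: (f / v') => y yX E.
rewrite -{}E; have : 0 <= (y - X) ^+ 2 * v' by rewrite mulr_ge0 ?sqr_ge0 ?ltW.
by nra.
Qed.

Lemma A_ge0 : 0 <= A.
Proof. exact: le_trans (le_trans (uv1 (0, 0)) (uvA _)). Qed.

Lemma C_ge0 : 0 <= C. Proof. by have := C1; lra. Qed.

Lemma CAB_ge0 : 0 <= C * A * B.
Proof. by rewrite !mulr_ge0 ?A_ge0 ?C_ge0 ?(ltW B0). Qed.

(** By the arithmetic-geometric mean inequality [X^2 v + Y^2 u] is at least [2 X Y] times the root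
    of [u v], and [u v >= 1]. The comparison is made between squares to avoid the root. *)
Lemma doob_sum_ge K (X Y : R) : 0 <= X -> 0 <= Y ->
  2 * C * A * B * (X * Y) <= doob_sum X Y K.
Proof.
move=> X0 Y0; rewrite /doob_sum.
have H1 := doob_ge X (v0 K) (pF K); have H2 := doob_ge Y (u0 K) (qG K).
suff : 2 * (X * Y) <= X ^+ 2 * v K + Y ^+ 2 * u K.
  move=> H; by have := ler_wpM2l CAB_ge0 (le_trans H (lerD H1 H2)); lra.
have S0 : 0 <= X ^+ 2 * v K + Y ^+ 2 * u K.
  by rewrite addr_ge0 // mulr_ge0 ?sqr_ge0 // ltW.
have T0 : 0 <= 2 * (X * Y) by rewrite !mulr_ge0.
rewrite -ler_sqr ?nnegrE // -subr_ge0.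
have -> : (X ^+ 2 * v K + Y ^+ 2 * u K) ^+ 2 - (2 * (X * Y)) ^+ 2 =
  (X ^+ 2 * v K - Y ^+ 2 * u K) ^+ 2 + 4 * ((X * Y) ^+ 2 * (u K * v K - 1)) by ring.
by rewrite addr_ge0 ?sqr_ge0 // !mulr_ge0 ?sqr_ge0 // subr_ge0.
Qed.

Lemma doob_sum_avg X Y K :
  doob_sum X Y K = (doob_sum X Y (left_half K) + doob_sum X Y (right_half K)) / 2.
Proof. rewrite /doob_sum /doob (mp K) (mF K) (mv K) (mq K) (mG K) (mu K). lra. Qed.

Lemma stop_level_martingale (P Q a : R) : 0 < P -> 0 < Q -> martingale (stop_level P Q a).
Proof.
by move=> P0 Q0 K; rewrite /stop_level (mp K) (mq K) (md a K); field; rewrite !gt_eqF.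
Qed.

Lemma stop_level_bound (P Q a c : R) K : 0 < P -> 0 < Q -> stop_level P Q a K <= c ->
  [/\ p K <= c * P, q K <= c * Q & d a K <= c * B].
Proof.
move=> P0 Q0; rewrite /stop_level => zc.
have z1 : 0 <= p K / P by rewrite divr_ge0 // ltW.
have z2 : 0 <= q K / Q by rewrite divr_ge0 ?carleson_q_ge0 // ltW.
have z3 : 0 <= d a K / B by rewrite divr_ge0 ?carleson_d_ge0 // ltW.
by rewrite -!ler_pdivrMr //; split; lra.
Qed.

Lemma stop_level_ge0 (P Q a : R) K : 0 < P -> 0 < Q -> 0 <= stop_level P Q a K.
Proof.
move=> P0 Q0; rewrite /stop_level !addr_ge0 // divr_ge0 ?(ltW P0, ltW Q0, ltW B0) //;
  [exact: carleson_q_ge0|exact: carleson_d_ge0].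
Qed.

Lemma local_energy_ge0 Q a K : 0 <= local_energy Q a K.
Proof. by rewrite /local_energy addr_ge0 // divr_ge0 ?energy_ge0 ?sqr_ge0. Qed.

Lemma local_energy_bound (P Q a : R) K : 0 < P -> 0 < Q -> stop_level P Q a K <= 12 ->
  local_energy Q a K <= 1440.
Proof.
move=> P0 Q0 /(stop_level_bound P0 Q0)[_ qQ dd]; rewrite /local_energy.
have Hb : energy a b K / B ^+ 2 <= 720.
  by rewrite ler_pdivrMr ?exprn_gt0 //; apply: (energy_bound (md a) _ dd).
have Hg : energy 0 g K / Q ^+ 2 <= 720.
  rewrite ler_pdivrMr ?exprn_gt0 //; apply: (energy_bound mq _ qQ) => J.
  by rewrite subr0.
by lra.
Qed.

Lemma local_energy_budget (P Q a : R) K : 0 < P -> 0 < Q -> stop_level P Q a K <= 12 ->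
  18 * local_energy Q a K <= C.
Proof.
move=> P0 Q0 z12; apply: le_trans C1.
by rewrite ler_pM2l //; exact: local_energy_bound z12.
Qed.

(** Before stopping [p K <= 6 * P]. With [x], [y] the values of [incr3],
    [2 x y <= B Q (x^2 / B^2 + y^2 / Q^2)], and [energy_avg] costs another 6: the constant is
    [6 * 6 / 2 = 18]. *)
Lemma carleson_term_bound (P Q a : R) K : 0 < P -> 0 < Q -> stop_level P Q a K <= 6 ->
  carleson_term K <= 18 * (B * (P * Q)) *
    ((local_energy Q a (left_half K) + local_energy Q a (right_half K)) / 2
     - local_energy Q a K).
Proof.
move=> P0 Q0 /(stop_level_bound P0 Q0)[pP _ _].
have Eb := energy_avg a K mb; have Eg := energy_avg 0 K mg.
rewrite /carleson_term /local_energy.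
have := p0 K.
have B2 : 0 < B ^+ 2 by rewrite exprn_gt0. have Q2 : 0 < Q ^+ 2 by rewrite exprn_gt0.
have i1 : 0 <= incr3 b K by rewrite /incr3 !addr_ge0.
have i2 : 0 <= incr3 g K by rewrite /incr3 !addr_ge0.
move: (incr3 b K) (incr3 g K) i1 i2 Eb Eg => x y x0 y0.
set DB := (X in _ <= 6 * X -> _); set DG := (X in _ -> _ <= 6 * X -> _).
move=> Eb Eg pK0.
have -> : (energy a b (left_half K) / B ^+ 2 + energy 0 g (left_half K) / Q ^+ 2 +
   (energy a b (right_half K) / B ^+ 2 + energy 0 g (right_half K) / Q ^+ 2)) / 2 -
  (energy a b K / B ^+ 2 + energy 0 g K / Q ^+ 2) = DB / B ^+ 2 + DG / Q ^+ 2.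
  by rewrite /DB /DG; field; rewrite !gt_eqF.
apply: (@le_trans _ _ (6 * P * (x * y))).
  by rewrite -mulrA ler_wpM2r ?mulr_ge0.
have -> : 18 * (B * (P * Q)) * (DB / B ^+ 2 + DG / Q ^+ 2) =
   3 * P / (B * Q) * (6 * DB * Q ^+ 2 + 6 * DG * B ^+ 2).
  by field; rewrite !gt_eqF.
have -> : 6 * P * (x * y) = 3 * P / (B * Q) * (2 * (x * y) * (B * Q)).
  by field; rewrite !gt_eqF.
rewrite ler_pM2l ?divr_gt0 ?mulr_gt0 //.
have := ler_wpM2r (ltW Q2) Eb; have := ler_wpM2r (ltW B2) Eg.
have := sqr_ge0 (x * Q - y * B); lra.
Qed.

Lemma reserve_le (P Q a X Y : R) K : 0 < P -> 0 < Q -> 0 <= X -> 0 <= Y ->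
  stop_level P Q a K <= 6 -> reserve P Q a X Y K <= 2 * C * A * B * (X * Y).
Proof.
move=> P0 Q0 X0 Y0 z6; rewrite /reserve.
have z12 : stop_level P Q a K <= 12 by lra.
have H1 : 0 <= B * (P * Q) * (C - 18 * local_energy Q a K).
  apply: mulr_ge0; first by rewrite !mulr_ge0 // ltW.
  by rewrite subr_ge0; exact: local_energy_budget z12.
have H2 : 0 <= C * A * B * (X * Y) * stop_level P Q a K.
  by rewrite !mulr_ge0 ?CAB_ge0 ?stop_level_ge0 // ?C_ge0 ?A_ge0 // ltW.
by move: H1 H2; lra.
Qed.

(** Above level 6 the first term of [reserve] is no longer positive, and up to level 12 the energy
    budget is not overdrawn. The old reserve can therefore be dropped at a stopping interval. *)
Lemma reserve_stopped (P Q a X Y : R) K : 0 < P -> 0 < Q -> 0 <= X -> 0 <= Y ->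
  6 <= stop_level P Q a K -> stop_level P Q a K <= 12 ->
  reserve P Q a X Y K <= 0.
Proof.
move=> P0 Q0 X0 Y0 z6 z12; rewrite /reserve.
have H1 : 0 <= B * (P * Q) * (C - 18 * local_energy Q a K).
  apply: mulr_ge0; first by rewrite !mulr_ge0 // ltW.
  by rewrite subr_ge0; exact: local_energy_budget z12.
have H2 : 0 <= C * A * B * (X * Y) * (stop_level P Q a K - 6).
  by apply: mulr_ge0; [rewrite !mulr_ge0 ?C_ge0 ?A_ge0 // ltW | rewrite subr_ge0].
by move: H1 H2; lra.
Qed.

(** At a new top each of the three parts of the level is at most 1, so at least half of
    [2 * C * A * B * (X * Y)] is available; by the [A_2] bound this half pays for the whole new
    budget [C * B * (p K * q K)]. *)
Lemma reserve_restart (X Y : R) K : 0 < p K -> 0 < q K ->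
  p K <= X * v K -> q K <= Y * u K -> 0 <= X -> 0 <= Y ->
  [/\ stop_level (p K) (q K) (b K) K <= 3, p K * q K <= A * (X * Y) &
      0 <= reserve (p K) (q K) (b K) X Y K].
Proof.
move=> pK qK pX qY X0 Y0.
have z3 : stop_level (p K) (q K) (b K) K <= 3.
  rewrite /stop_level !divff ?gt_eqF //.
  have : d (b K) K / B <= 1 by rewrite ler_pdivrMr // mul1r.
  by lra.
have pq : p K * q K <= A * (X * Y).
  apply: (@le_trans _ _ (X * v K * (Y * u K))).
    by rewrite ler_pM ?(ltW pK, ltW qK).
  have := ler_wpM2r (mulr_ge0 X0 Y0) (uvA K).
  by have -> : X * v K * (Y * u K) = u K * v K * (X * Y) by ring.
split=> //; rewrite /reserve.
have H1 : 0 <= B * (p K * q K) * local_energy (q K) (b K) K.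
  by rewrite !mulr_ge0 ?local_energy_ge0 // ltW.
have H2 : 0 <= C * A * B * (X * Y) * (3 - stop_level (p K) (q K) (b K) K).
  by apply: mulr_ge0; [rewrite !mulr_ge0 ?C_ge0 ?A_ge0 // ltW | rewrite subr_ge0].
have H3 := ler_wpM2l (mulr_ge0 C_ge0 (ltW B0)) pq.
by move: H1 H2 H3; lra.
Qed.

Lemma reserve_step (P Q a X Y : R) K : 0 < P -> 0 < Q ->
  stop_level P Q a K <= 6 -> carleson_term K + reserve P Q a X Y K <=
  (reserve P Q a X Y (left_half K) + reserve P Q a X Y (right_half K)) / 2.
Proof.
move=> P0 Q0 z6; have := carleson_term_bound P0 Q0 z6.
by rewrite /reserve (stop_level_martingale a P0 Q0 K); lra.
Qed.

Lemma tree_sum_reserve n K (P Q a X Y : R) :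
  0 < P -> 0 < Q -> stop_level P Q a K <= 6 ->
  p K <= X * v K -> q K <= Y * u K -> 0 <= X -> 0 <= Y -> P * Q <= A * (X * Y) ->
  tree_sum carleson_term n K + reserve P Q a X Y K <= doob_sum X Y K.
Proof.
have average (t a1 a2 r r1 r2 s1 s2 : R) : t + r <= (r1 + r2) / 2 ->
    a1 + r1 <= s1 -> a2 + r2 <= s2 -> t + (a1 + a2) / 2 + r <= (s1 + s2) / 2.
  by lra.
elim: n K P Q a X Y => [|n IH] K P Q a X Y P0 Q0 z6 pX qY X0 Y0 PQ.
  by rewrite add0r; apply: le_trans (doob_sum_ge K X0 Y0); exact: reserve_le.
(* This is applied to the two halves of [K], whose level is at most twice that of [K]. Updating the
   maxima lowers [doob_sum] and, as long as the level is at most 6, raises [reserve]. *)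
have step J : stop_level P Q a J <= 12 ->
    tree_sum carleson_term n J + reserve P Q a X Y J <= doob_sum X Y J.
  move=> z12.
  set X' := Num.max X (p J / v J); set Y' := Num.max Y (q J / u J).
  have [pX' dX] := doob_max (p J) (F J) X (v0 J).
  have [qY' dY] := doob_max (q J) (G J) Y (u0 J).
  have XX' : X <= X' by rewrite le_max lexx.
  have YY' : Y <= Y' by rewrite le_max lexx.
  have X'0 := le_trans X0 XX'; have Y'0 := le_trans Y0 YY'.
  have XY : X * Y <= X' * Y' by rewrite ler_pM.
  have PQ' : P * Q <= A * (X' * Y').
    by apply: le_trans PQ _; rewrite ler_wpM2l // A_ge0.
  have dXY : doob_sum X' Y' J <= doob_sum X Y J.
    exact: ler_wpM2l CAB_ge0 _ _ (lerD dX dY).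
  apply: le_trans dXY; have [z6'|z6'] := leP (stop_level P Q a J) 6.
    apply: le_trans (IH _ _ _ _ _ _ P0 Q0 z6' pX' qY' X'0 Y'0 PQ').
    rewrite lerD2l /reserve lerD2r ler_wpM2r ?subr_ge0 ?ler_pdivrMr ?mul1r //.
    by rewrite ler_wpM2l // -!mulrA mulr_ge0 // !mulrA CAB_ge0.
  (* [J] is a stopping interval: its old reserve, at most 0, is exchanged for a fresh one, at least
     0. *)
  have old0 := reserve_stopped P0 Q0 X0 Y0 (ltW z6') z12.
  have doob0 : 0 <= doob_sum X' Y' J.
    apply: le_trans (doob_sum_ge J X'0 Y'0); apply: mulr_ge0 (mulr_ge0 X'0 Y'0).
    by rewrite -!mulrA mulr_ge0 // !mulrA CAB_ge0.
  have [pJ|pJ] := eqVneq (p J) 0.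
    by rewrite tree_sum_eq0 ?add0r; [exact: le_trans old0 doob0|left].
  have [qJ|qJ] := eqVneq (q J) 0.
    by rewrite tree_sum_eq0 ?add0r; [exact: le_trans old0 doob0|right].
  have pJ0 : 0 < p J by rewrite lt_def pJ p0.
  have qJ0 : 0 < q J by rewrite lt_def qJ carleson_q_ge0.
  have [z3 pq new0] := reserve_restart pJ0 qJ0 pX' qY' X'0 Y'0.
  have z6J : stop_level (p J) (q J) (b J) J <= 6 by rewrite (le_trans z3) // ler_nat.
  apply: le_trans (IH J _ _ (b J) X' Y' pJ0 qJ0 z6J pX' qY' X'0 Y'0 pq).
  by rewrite lerD2l (le_trans old0).
have [zl zr] := nneg_kids K (stop_level_martingale a P0 Q0)
  (fun J => stop_level_ge0 a J P0 Q0).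
have z12 : 2 * stop_level P Q a K <= 12.
  by rewrite (_ : 12 = 2 * 6) ?ler_pM2l // -natrM.
rewrite doob_sum_avg /=; apply: average (step _ (le_trans zl z12)) (step _ (le_trans zr z12)).
exact: reserve_step.
Qed.

(** [K] itself is taken as the first stopping interval, with [X = p K / v K] and [Y = q K / u K];
    for these values [doob] is at most [4 * F K], respectively [4 * G K]. *)
Lemma tree_sum_bound n K :
  tree_sum carleson_term n K <= 4 * C * A * B * (F K + G K).
Proof.
have F0 : 0 <= F K by rewrite -(pmulr_lge0 _ (v0 K)) (le_trans (sqr_ge0 (p K))).
have G0 : 0 <= G K by rewrite -(pmulr_lge0 _ (u0 K)) (le_trans (sqr_ge0 (q K))).
have R0 : 0 <= 4 * C * A * B * (F K + G K).
  by rewrite mulr_ge0 ?addr_ge0 // -!mulrA mulr_ge0 // !mulrA CAB_ge0.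
have [pK|pK] := eqVneq (p K) 0; first by rewrite tree_sum_eq0 //; left.
have [qK|qK] := eqVneq (q K) 0; first by rewrite tree_sum_eq0 //; right.
have pK0 : 0 < p K by rewrite lt_def pK p0.
have qK0 : 0 < q K by rewrite lt_def qK carleson_q_ge0.
have X0 : 0 <= p K / v K by rewrite divr_ge0 // ltW.
have Y0 : 0 <= q K / u K by rewrite divr_ge0 // ltW.
have Ep : p K / v K * v K = p K by rewrite divfK ?gt_eqF.
have Eq : q K / u K * u K = q K by rewrite divfK ?gt_eqF.
have pX : p K <= p K / v K * v K by rewrite Ep.
have qY : q K <= q K / u K * u K by rewrite Eq.
have [z3 pq res0] := reserve_restart pK0 qK0 pX qY X0 Y0.
have z6 : stop_level (p K) (q K) (b K) K <= 6 by rewrite (le_trans z3) // ler_nat.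
have H : tree_sum carleson_term n K <= doob_sum (p K / v K) (q K / u K) K.
  apply: le_trans (tree_sum_reserve n pK0 qK0 z6 pX qY X0 Y0 pq).
  by rewrite lerDl.
apply: (le_trans H); rewrite /doob_sum /doob.
have top (x y z t : R) : 0 <= z -> y * z = x ->
    4 * t - 4 * x * y + 2 * y ^+ 2 * z <= 4 * t.
  move=> z0 <-; have : 0 <= y ^+ 2 * z by rewrite mulr_ge0 ?sqr_ge0.
  by lra.
have := ler_wpM2l CAB_ge0 (lerD (top _ _ _ (F K) (ltW (v0 K)) Ep)
  (top _ _ _ (G K) (ltW (u0 K)) Eq)).
by lra.
Qed.

End CarlesonForm.
End Tree.

(** * Dyadic intervals and averages *)

Section Geometry.
Variable R : realType.
Local Notation mu := (@lebesgue_measure R).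
Local Notation len := (@dyadic_len R).
Local Notation dset := (@dyadic_set R).
Implicit Types I J K : dyadic.

Lemma dyadic_len_gt0 I : 0 < len I.
Proof. by rewrite exprz_gt0. Qed.

Lemma dyadic_len_half I J : J.1 = I.1 + 1 -> len J = len I / 2.
Proof. by rewrite /dyadic_len => ->; rewrite opprD expfzDr ?pnatr_eq0. Qed.

Lemma dyadic_len_left I : len (left_half I) = len I / 2.
Proof. exact: dyadic_len_half. Qed.

Lemma dyadic_len_right I : len (right_half I) = len I / 2.
Proof. exact: dyadic_len_half. Qed.

Lemma in_dyadic_set I (x : R) :
  dset I x <-> I.2%:~R * len I <= x < (I.2%:~R + 1) * len I.
Proof. by rewrite /dyadic_set /= in_itv /= intrD. Qed.

Lemma measurable_dyadic_set I : measurable (dset I : set (measurableTypeR R)).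
Proof. exact: measurable_itv. Qed.

Lemma dyadic_set_setU I :
  dset I = dset (left_half I) `|` dset (right_half I).
Proof.
apply/seteqP; split => x; rewrite /setU /= !in_dyadic_set dyadic_len_left
  dyadic_len_right /= ?intrD ?intrM.
  move=> xI; have [|] := ltP x ((2%:~R * I.2%:~R + 1) * (len I / 2)) => h.
    by left; lra.
  by right; lra.
by have := dyadic_len_gt0 I; move=> ? []; lra.
Qed.

Lemma dyadic_set_disjoint I J x : I.1 = J.1 -> dset I x -> dset J x -> I = J.
Proof.
case: I J => [i k] [j l] /= <-; rewrite !in_dyadic_set /=.
have := dyadic_len_gt0 (i, k); rewrite /dyadic_len /=; move: (_ ^ _ : R) => e e0.
move=> /andP[a b] /andP[c f].
have : (k%:~R : R) < (l + 1)%:~R.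
  by rewrite intrD -(ltr_pM2r e0); exact: le_lt_trans f.
have : (l%:~R : R) < (k + 1)%:~R.
  by rewrite intrD -(ltr_pM2r e0); exact: le_lt_trans b.
by rewrite !ltr_int !ltzD1 => lk kl; congr pair; apply/eqP; rewrite eq_le lk kl.
Qed.

Definition parent I : dyadic := (I.1 - 1, (I.2 %/ 2)%Z).

Lemma parentP I : I = left_half (parent I) \/ I = right_half (parent I).
Proof.
case: I => j k; rewrite /left_half /right_half /parent /= subrK.
have k2 := divz_eq k 2; have := modz_ge0 k (isT : (2 : int) != 0).
have := ltz_pmod k (isT : (0 : int) < 2).
move: (k %% 2)%Z k2 => [[|[|//]]|//] k2 _ _.
  by left; congr pair; rewrite {1}k2 addr0 mulrC.
by right; congr pair; rewrite {1}k2 mulrC.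
Qed.

Lemma dyadic_set_parent I : dset I `<=` dset (parent I).
Proof.
rewrite (dyadic_set_setU (parent I)).
by case: (parentP I) => {1}-> x Ix; [left|right].
Qed.

Lemma dyadic_nested I J : I.1 <= J.1 ->
  dset J `<=` dset I \/ dset J `&` dset I = set0.
Proof.
rewrite -subr_ge0; move E : (J.1 - I.1) => [n|//] _.
elim: n J E => [|n IH] J E.
  have JI : J.1 = I.1 by apply/eqP; rewrite -subr_eq0 E.
  have [->|neq] := eqVneq J I; first by left.
  right; apply/seteqP; split=> // x [Jx Ix].
  by move/eqP: neq; apply; exact: dyadic_set_disjoint JI Jx Ix.
have Ep : (parent J).1 - I.1 = n by rewrite /= addrAC E intS addrAC subrr add0r.
case: (IH (parent J) Ep) => [h|h].
  by left; apply: subset_trans h; exact: dyadic_set_parent.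
right; rewrite -subset0 -h; apply: setSI; exact: dyadic_set_parent.
Qed.

Lemma lebesgue_dyadic_set I : mu (dset I) = (len I)%:E.
Proof.
rewrite /dyadic_set lebesgue_measure_itv /= lte_fin -EFinB.
rewrite ltr_pM2r ?dyadic_len_gt0 // ltr_int ltrDl ltr01.
by rewrite -mulrBl intrD addrAC subrr add0r mul1r.
Qed.

Lemma dyadic_halves_disj I : [disjoint dset (left_half I) & dset (right_half I)].
Proof.
apply/disj_setPS => x [/= l r]; have := dyadic_set_disjoint _ l r.
move=> /(_ erefl) []; rewrite -[LHS]addr0 => /addrI; exact/eqP.
Qed.

End Geometry.
#[global] Hint Extern 0 (measurable _) => solve [apply: measurable_dyadic_set] : core.

Section Averages.
Variable R : realType.
Local Notation mu := (@lebesgue_measure R).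
Local Notation len := (@dyadic_len R).
Local Notation dset := (@dyadic_set R).
Implicit Types (I J K : dyadic) (f g : R -> R).

Definition dyadic_integrable f : Prop :=
  forall I, mu.-integrable (dset I) (EFin \o f).

Lemma locally_integrable_dyadic f :
  locally_integrable setT f -> dyadic_integrable f.
Proof.
move=> [mf _ Kf] I; apply/integrableP; split.
  by apply/measurable_EFinP; exact: measurable_funS mf.
set J := `[I.2%:~R * len I, (I.2 + 1)%:~R * len I]%classic.
have IJ : dset I `<=` J.
  by move=> x; rewrite /dyadic_set /J /= !in_itv /= => /andP[-> /ltW].
have cJ : compact J by exact: segment_compact.
apply: (le_lt_trans _ (Kf J (@subsetT _ _) cJ)).
apply: ge0_subset_integral => //=.
- exact: compact_measurable.
- apply/measurable_EFinP; apply: measurableT_comp => //; exact: measurable_funS mf.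
Qed.

Lemma integrable_dyadic f :
  mu.-integrable setT (EFin \o f) -> dyadic_integrable f.
Proof. by move=> fi I; apply: integrableS fi => //; exact: measurable_dyadic_set. Qed.

Lemma dyadic_integrable_norm f :
  dyadic_integrable f -> dyadic_integrable (fun x => `|f x|).
Proof. by move=> fi I; have := integrable_norm (fi I). Qed.

Lemma dyadic_integrable_cst (c : R) : dyadic_integrable (cst c).
Proof.
move=> I; apply: measurable_bounded_integrable => //.
  by rewrite [X in (X < _)%E]lebesgue_dyadic_set ltry.
exact: bounded_cst.
Qed.

Lemma dyadic_integrableB f g : dyadic_integrable f -> dyadic_integrable g ->
  dyadic_integrable (fun x => f x - g x).
Proof.
move=> fi gi I; have := integrableB (@measurable_dyadic_set R I) (fi I) (gi I).
by apply: eq_integrable.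
Qed.

Lemma avgE f I : \int[mu]_(x in dset I) f x = len I * avg f I.
Proof. by rewrite /avg mulrA mulfV ?mul1r // gt_eqF // dyadic_len_gt0. Qed.

Lemma avg_martingale f : dyadic_integrable f -> martingale (avg f).
Proof.
move=> fi I; apply: (mulfI (lt0r_neq0 (dyadic_len_gt0 R I))).
rewrite -avgE {1}dyadic_set_setU Rintegral_setU //; last 2 first.
- by rewrite -dyadic_set_setU.
- exact: dyadic_halves_disj.
rewrite !avgE dyadic_len_left dyadic_len_right; lra.
Qed.

Lemma avg_cst (c : R) I : avg (cst c) I = c.
Proof.
rewrite /avg Rintegral_cst // [X in fine X]lebesgue_dyadic_set /= mulrCA mulVf ?mulr1 //.
by rewrite gt_eqF // dyadic_len_gt0.
Qed.

Lemma avgB f g I : dyadic_integrable f -> dyadic_integrable g ->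
  avg (fun x => f x - g x) I = avg f I - avg g I.
Proof. by move=> fi gi; rewrite /avg RintegralB // mulrBr. Qed.

Lemma ler_norm_avg f I : dyadic_integrable f ->
  `|avg f I| <= avg (fun x => `|f x|) I.
Proof.
move=> fi; rewrite /avg normrM gtr0_norm ?invr_gt0 ?dyadic_len_gt0 //.
by rewrite ler_pM2l ?invr_gt0 ?dyadic_len_gt0 // le_normr_Rintegral.
Qed.

Lemma avg_ge0 f I : (forall x, 0 <= f x) -> 0 <= avg f I.
Proof.
by move=> f0; rewrite /avg mulr_ge0 ?invr_ge0 ?(ltW (dyadic_len_gt0 _ _)) //
  Rintegral_ge0.
Qed.

Lemma ler_dist_avg f I (a : R) : dyadic_integrable f ->
  `|avg f I - a| <= avg (fun x => `|f x - a|) I.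
Proof.
move=> fi; rewrite -{1}(avg_cst a I) -avgB //; last exact: dyadic_integrable_cst.
by apply: ler_norm_avg; apply: dyadic_integrableB (dyadic_integrable_cst a).
Qed.

Lemma Rintegral_mul_indic f I :
  \int[mu]_x (f x * \1_(dset I) x) = \int[mu]_(x in dset I) f x.
Proof.
rewrite [RHS]Rintegral_mkcond; apply: eq_Rintegral => x _.
by rewrite patchE indicE; case: ifP => _; rewrite ?mulr1 ?mulr0.
Qed.

Lemma integrable_mul_indic f I : dyadic_integrable f ->
  mu.-integrable setT (EFin \o (fun x => f x * \1_(dset I) x)).
Proof.
move=> fi; have /(integrable_mkcond _ (@measurable_dyadic_set R I)) := fi I.
apply: eq_integrable => // x _ /=; rewrite patchE indicE.
by case: ifP => _; rewrite ?mulr1 ?mulr0.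
Qed.

Lemma inner_haar f I : dyadic_integrable f ->
  inner f (haar I) = Num.sqrt (len I) * incr (avg f) I.
Proof.
move=> fi; rewrite /inner /haar.
have l0 := dyadic_len_gt0 R I; have s0 : 0 < Num.sqrt (len I) by rewrite sqrtr_gt0.
have ir := integrable_mul_indic (right_half I) fi.
have il := integrable_mul_indic (left_half I) fi.
under eq_Rintegral do rewrite mulrCA mulrBr.
rewrite RintegralZl //; last by have := integrableB measurableT ir il; exact: eq_integrable.
rewrite RintegralB // !Rintegral_mul_indic !avgE dyadic_len_left dyadic_len_right.
rewrite -{2 3}(sqr_sqrtr (ltW l0)) /incr.
by field; rewrite gt_eqF.
Qed.

(** Optimising [2 p <= t F + v / t] at [t = v / p]. The integrand of the difference is
    [(t |f| w - 1)^2 s / t], a square because [s w = 1]. *)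
Lemma avg_cauchy_schwarz f w s I :
  dyadic_integrable f -> dyadic_integrable (fun x => f x ^+ 2 * w x) ->
  dyadic_integrable s -> (forall x, 0 < w x) -> (forall x, s x * w x = 1) ->
  avg (fun x => `|f x|) I ^+ 2 <= avg (fun x => f x ^+ 2 * w x) I * avg s I.
Proof.
move=> fi fwi si w0 sw.
have s0 x : 0 < s x by rewrite -(pmulr_lgt0 _ (w0 x)) sw.
set p := avg _ I; set F := avg _ I; set v := avg _ I.
have p0 : 0 <= p by apply: avg_ge0.
have F0 : 0 <= F by apply: avg_ge0 => x; rewrite mulr_ge0 ?sqr_ge0 // ltW.
have v0 : 0 <= v by apply: avg_ge0 => x; rewrite ltW.
have key (t : R) : 0 < t -> 2 * p <= t * F + t^-1 * v.
  move=> t0; rewrite /p /F /v /avg.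
  rewrite !(mulrCA _ (len I)^-1) -mulrDr ler_pM2l ?invr_gt0 ?dyadic_len_gt0 //.
  have i1 : mu.-integrable (dset I) (EFin \o (fun x => t * (f x ^+ 2 * w x))).
    by have := integrableZl (@measurable_dyadic_set R I) t (fwi I).
  have i2 : mu.-integrable (dset I) (EFin \o (fun x => t^-1 * s x)).
    by have := integrableZl (@measurable_dyadic_set R I) t^-1 (si I).
  have nf := dyadic_integrable_norm fi.
  rewrite -!RintegralZl // -RintegralD //; apply: le_Rintegral => //.
  - by have := integrableZl (@measurable_dyadic_set R I) 2 (nf I).
  - by have := integrableD (@measurable_dyadic_set R I) i1 i2.
  move=> x _.
  have -> : t * (f x ^+ 2 * w x) + t^-1 * s x =
     2 * `|f x| + (t * `|f x| * w x - 1) ^+ 2 * (t^-1 * s x).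
    rewrite -(real_normK (num_real (f x))).
    have -> : w x = (s x)^-1.
      by apply: (mulfI (lt0r_neq0 (s0 x))); rewrite sw mulfV ?gt_eqF.
    by field; rewrite !gt_eqF.
  by rewrite lerDl mulr_ge0 ?sqr_ge0 // mulr_ge0 ?invr_ge0 ?ltW.
have [->|p1] := eqVneq p 0; first by rewrite expr0n mulr_ge0.
have pp : 0 < p by rewrite lt_def p1.
have vp : 0 < v.
  rewrite lt_def v0 andbT; apply/eqP => v1.
  have Fp : 0 <= F / p + 1 by rewrite addr_ge0 ?divr_ge0 ?ler01 // ltW.
  (* If [v = 0], this [t] makes [t * F <= p], against [2 * p <= t * F]. *)
  have := key (p / (F + p)) ltac:(by rewrite divr_gt0 // ltr_wpDl).
  rewrite v1 mulr0 addr0 => h.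
  have : p / (F + p) * F <= p.
    by rewrite mulrAC ler_pdivrMr ?ltr_wpDl // ler_wpM2l //; lra.
  by lra.
have := key (v / p) (divr_gt0 vp pp); rewrite invf_div.
have -> : p / v * v = p by rewrite divfK ?gt_eqF.
rewrite mulrAC => h; have : p <= v * F / p by lra.
by rewrite ler_pdivlMr // (mulrC F).
Qed.

End Averages.

(** * Haar series in L^2 *)

Section SquareIntegrable.
Variable R : realType.
Local Notation mu := (@lebesgue_measure R).
Local Notation len := (@dyadic_len R).
Local Notation dset := (@dyadic_set R).
Implicit Types (I J K : dyadic) (f g : R -> R) (c : dyadic -> R -> R).

Definition sqint f : Prop :=
  measurable_fun [set: R] f /\ mu.-integrable setT (EFin \o (fun x => f x ^+ 2)).

Lemma Lfun_sqint f : (f : measurableTypeR R -> R) \in Lfun mu 2%:E -> sqint f.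
Proof.
move=> fL; split; last exact: Lfun2_integrable_sqr.
by move: fL; rewrite inE => /andP[]; rewrite inE.
Qed.

Lemma sqint_mul f g : sqint f -> sqint g ->
  mu.-integrable setT (EFin \o (fun x => f x * g x)).
Proof.
move=> [mf fi] [mg gi].
have fgi := integrableD measurableT fi gi.
apply: (le_integrable measurableT _ _ fgi).
  by apply/measurable_EFinP; exact: measurable_funM.
move=> x _ /=; rewrite lee_fin [X in _ <= X]ger0_norm ?addr_ge0 ?sqr_ge0 //.
rewrite normrM -(real_normK (num_real (f x))) -(real_normK (num_real (g x))).
have := sqr_ge0 (`|f x| - `|g x|); have := sqr_ge0 (`|f x| + `|g x|).
by nra.
Qed.

Lemma sqintD f g : sqint f -> sqint g -> sqint (fun x => f x + g x).
Proof.
move=> sf sg; have fg := sqint_mul sf sg; case: sf sg => mf fi [mg gi].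
split; first exact: measurable_funD.
have i1 := integrableD measurableT fi gi.
have i2 := integrableZl measurableT 2 fg.
have := integrableD measurableT i1 i2; apply: eq_integrable => // x _ /=.
by rewrite -EFinM -!EFinD; congr EFin; ring.
Qed.

Lemma sqintZ (a : R) f : sqint f -> sqint (fun x => a * f x).
Proof.
move=> [mf fi]; split; first exact: measurable_funM.
have := integrableZl measurableT (a ^+ 2) fi; apply: eq_integrable => // x _ /=.
by rewrite -EFinM exprMn.
Qed.

Lemma sqint0 : sqint (fun=> 0).
Proof.
split; first exact: measurable_cst.
have := integrable0 mu (@setT R); apply: eq_integrable => // x _ /=.
by rewrite expr0n.
Qed.

Lemma sqintB f g : sqint f -> sqint g -> sqint (fun x => f x - g x).
Proof.
move=> sf sg; have := sqintD sf (sqintZ (-1) sg).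
by congr sqint; apply/funext => x; rewrite mulN1r.
Qed.

Lemma sqint_sum c (s : seq dyadic) : (forall I, sqint (c I)) ->
  sqint (fun x => \sum_(I <- s) c I x).
Proof.
move=> ci; elim: s => [|I s IH].
  by have := sqint0; congr sqint; apply/funext => x; rewrite big_nil.
by have := sqintD (ci I) IH; congr sqint; apply/funext => x; rewrite big_cons.
Qed.

Lemma sqint_indic I : sqint (\1_(dset I)).
Proof.
split; first exact: measurable_indic.
have := integrable_mul_indic I (dyadic_integrable_cst (1 : R)).
apply: eq_integrable => // x _ /=; rewrite mul1r indicE.
by case: (_ \in _); rewrite ?expr1n ?expr0n.
Qed.

Lemma sqint_haar I : sqint (haar I).
Proof. by apply: sqintZ; apply: sqintB; apply: sqint_indic. Qed.

Lemma haar_sqr I x : (haar I x : R) ^+ 2 = (len I)^-1 * \1_(dset I) x.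
Proof.
rewrite /haar exprMn exprVn sqr_sqrtr ?(ltW (dyadic_len_gt0 _ _)) //.
congr (_ * _); rewrite (dyadic_set_setU R I) !indicE in_setU.
have /disj_setPS/(_ x) := dyadic_halves_disj R I.
have [/set_mem l|_] := boolP (x \in dset (left_half I));
  have [/set_mem r|_] := boolP (x \in dset (right_half I)); rewrite /= ?mulr0n ?mulr1n => H.
- by have := H (conj l r).
- by rewrite sub0r sqrrN expr1n.
- by rewrite subr0 expr1n.
- by rewrite subrr expr0n.
Qed.

Lemma sqint_haar_sqr I : sqint (fun x => haar I x ^+ 2).
Proof.
have := sqintZ (len I)^-1 (sqint_indic I); congr sqint.
by apply/funext => x; rewrite haar_sqr.
Qed.

Lemma sqint_dyadic f : sqint f -> dyadic_integrable f.
Proof.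
move=> sf I; have := sqint_mul sf (sqint_indic I).
move=> fi; apply/(integrable_mkcond _ (@measurable_dyadic_set R I)).
apply: eq_integrable fi => // x _ /=; rewrite patchE indicE.
by case: ifP => _; rewrite ?mulr1 ?mulr0.
Qed.

Lemma innerC f g : inner f g = inner g f.
Proof. by apply: eq_Rintegral => x _; rewrite mulrC. Qed.

Lemma innerDl f g h : sqint f -> sqint g -> sqint h ->
  inner (fun x => f x + g x) h = inner f h + inner g h.
Proof.
move=> sf sg sh; rewrite /inner; under eq_Rintegral do rewrite mulrDl.
by rewrite RintegralD //; apply: sqint_mul.
Qed.

Lemma innerZl (a : R) f g : sqint f -> sqint g ->
  inner (fun x => a * f x) g = a * inner f g.
Proof.
move=> sf sg; rewrite /inner; under eq_Rintegral do rewrite -mulrA.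
by rewrite RintegralZl //; apply: sqint_mul.
Qed.

Lemma innerBl f g h : sqint f -> sqint g -> sqint h ->
  inner (fun x => f x - g x) h = inner f h - inner g h.
Proof.
move=> sf sg sh; rewrite /inner; under eq_Rintegral do rewrite mulrBl.
by rewrite RintegralB //; apply: sqint_mul.
Qed.

Lemma inner0l g : inner (fun=> 0) g = 0 :> R.
Proof.
rewrite /inner; under eq_Rintegral do rewrite mul0r.
by rewrite Rintegral_cst // mul0r.
Qed.

Lemma inner_suml c (s : seq dyadic) g : (forall I, sqint (c I)) -> sqint g ->
  inner (fun x => \sum_(I <- s) c I x) g = \sum_(I <- s) inner (c I) g.
Proof.
move=> ci sg; elim: s => [|I s IH].
  rewrite big_nil -[RHS](inner0l g); congr inner.
  by apply/funext => x; rewrite big_nil.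
rewrite big_cons -IH -innerDl //; last exact: sqint_sum.
by congr inner; apply/funext => x; rewrite big_cons.
Qed.

Lemma inner_young f g (e : R) : 0 < e -> sqint f -> sqint g ->
  2 * `|inner f g| <= e^-1 * (\int[mu]_x (f x ^+ 2)) + e * (\int[mu]_x (g x ^+ 2)).
Proof.
move=> e0 sf sg; have fg := sqint_mul sf sg; case: sf sg => mf fi [mg gi].
have i1 : mu.-integrable setT (EFin \o (fun x => e^-1 * f x ^+ 2)).
  by have := integrableZl measurableT e^-1 fi.
have i2 : mu.-integrable setT (EFin \o (fun x => e * g x ^+ 2)).
  by have := integrableZl measurableT e gi.
apply: (@le_trans _ _ (2 * \int[mu]_x `|f x * g x|)).
  by rewrite ler_pM2l // le_normr_Rintegral.
have fg' := integrable_norm fg.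
rewrite -!RintegralZl // -RintegralD //; apply: le_Rintegral => //.
- by have := integrableZl measurableT 2 fg'.
- by have := integrableD measurableT i1 i2.
move=> x _; rewrite normrM -(real_normK (num_real (f x))).
rewrite -(real_normK (num_real (g x))) -subr_ge0.
have -> : e^-1 * `|f x| ^+ 2 + e * `|g x| ^+ 2 - 2 * (`|f x| * `|g x|) =
  e^-1 * (`|f x| - e * `|g x|) ^+ 2 by field; rewrite gt_eqF.
by rewrite mulr_ge0 ?sqr_ge0 // invr_ge0 ltW.
Qed.

Lemma Lnorm2_lt f (e : R) : sqint f -> 0 < e ->
  ('N[mu]_2%:E[EFin \o f] < e%:E)%E -> \int[mu]_x (f x ^+ 2) <= e ^+ 2.
Proof.
move=> [mf fi] e0 h.
have : ('N[mu]_2%:E[EFin \o f] `^ 2 <= e%:E `^ 2)%E.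
  rewrite gt0_ler_poweR ?in_itv //= ?leey ?andbT ?Lnorm_ge0 ?lee_fin ?(ltW e0) //.
  exact: ltW.
rewrite poweR_Lnorm // poweR_EFin powR_mulrn ?(ltW e0) // => H.
have E : (\int[mu]_x (`|(EFin \o f) x| `^ 2) =
    \int[mu]_x (EFin \o (fun x => (f x ^+ 2)%R)) x)%E.
  apply: eq_integral => x _ /=; rewrite powR_mulrn //.
  by rewrite real_normK ?num_real.
rewrite E in H; rewrite /Rintegral -lee_fin fineK //.
exact: integrable_fin_num.
Qed.

Lemma L2_sum_inner c g phi (F1 : {fset dyadic}) (e : R) :
  (forall I, sqint (c I)) -> L2_sum c g -> sqint phi -> 0 < e ->
  exists F : {fset dyadic}, (F1 `<=` F)%fset /\
    `|inner g phi - \sum_(I <- F) inner (c I) phi| <= e.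
Proof.
move=> ci [/Lfun_sqint sg gc] sphi e0.
set M := \int[mu]_x (phi x ^+ 2).
have M0 : 0 <= M by apply: Rintegral_ge0 => x _; exact: sqr_ge0.
have M1 : 0 < 1 + M by lra.
have d0 : 0 < e / (1 + M) by rewrite divr_gt0.
have [F0 /(_ (F0 `|` F1)%fset (fsubsetUl _ _)) H] := gc _ d0.
exists (F0 `|` F1)%fset; split; first exact: fsubsetUr.
have ss := sqint_sum (F0 `|` F1)%fset ci.
have sd := sqintB sg ss.
rewrite -inner_suml // -innerBl //.
have := inner_young d0 sd sphi; have := Lnorm2_lt sd d0 H.
set d := e / (1 + M) in d0 *; set N := \int[mu]_x _ => Nd; rewrite -/M => Y.
have : d^-1 * N <= d.
  by rewrite ler_pdivrMl // -expr2.
have dM : d * (1 + M) = e by rewrite /d divfK // gt_eqF.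
by move: Y; set X := `|_|; nra.
Qed.

End SquareIntegrable.

(** * Orthonormality of the Haar functions and coefficients of the operators *)

Section HaarSeries.
Variable R : realType.
Local Notation mu := (@lebesgue_measure R).
Local Notation len := (@dyadic_len R).
Local Notation dset := (@dyadic_set R).
Implicit Types (I J K : dyadic) (f g phi : R -> R) (c : dyadic -> R -> R).

Lemma haar_out I (x : R) : ~ dset I x -> haar I x = 0.
Proof.
move=> nI; have := haar_sqr I x; rewrite indicE memNset // mulr0.
by move/eqP; rewrite sqrf_eq0 => /eqP.
Qed.

Lemma inner_haar_orthonormal I J : inner (haar I) (haar J) = (I == J)%:R :> R.
Proof.
wlog IJ : I J / I.1 <= J.1 => [W|].
  by have [/W //|/ltW/W] := leP I.1 J.1; rewrite innerC eq_sym.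
have [<-|neq] := eqVneq I J.
  rewrite /inner; under eq_Rintegral do rewrite -expr2 haar_sqr.
  have i1 : mu.-integrable setT (EFin \o (\1_(dset I) : R -> R)).
    have := integrable_mul_indic I (dyadic_integrable_cst (1 : R)).
    by apply: eq_integrable => // x _ /=; rewrite mul1r.
  rewrite RintegralZl //.
  have -> : \int[mu]_x (\1_(dset I) x : R) = \int[mu]_x (cst 1 x * \1_(dset I) x).
    by apply: eq_Rintegral => x _; rewrite mul1r.
  rewrite Rintegral_mul_indic avgE avg_cst mulr1 mulVf //.
  by rewrite gt_eqF // dyadic_len_gt0.
have [E|E] := eqVneq I.1 J.1.
  rewrite -[RHS](inner0l (haar J)); apply: eq_Rintegral => x _.
  rewrite mul0r; have [Ix|nIx] := pselect (dset I x).
    have [Jx|nJx] := pselect (dset J x); last by rewrite (haar_out nJx) mulr0.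
    by move/eqP: neq; case; exact: dyadic_set_disjoint E Ix Jx.
  by rewrite (haar_out nIx) mul0r.
have IJ1 : I.1 + 1 <= J.1 by rewrite lezD1 lt_def eq_sym E.
(* For strictly finer [J], each half of [I] contains [J] or misses it. So [haar I] is constant on
   the support of [haar J], which has mean zero. *)
have cst K : K.1 = I.1 + 1 -> exists a : R, forall x,
    \1_(dset K) x * haar J x = a * haar J x.
  move=> KI; have [JK|JK] := @dyadic_nested R K J ltac:(by rewrite KI).
    exists 1 => x; have [Jx|nJx] := pselect (dset J x).
      by rewrite indicE mem_set //; exact: JK.
    by rewrite (haar_out nJx) !mulr0.
  exists 0 => x; have [Jx|nJx] := pselect (dset J x).
    rewrite indicE memNset // => Kx.
    by have : (dset J `&` dset K) x by []; rewrite JK.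
  by rewrite (haar_out nJx) !mulr0.
have [a Ha] := cst (right_half I) erefl; have [b Hb] := cst (left_half I) erefl.
have -> : inner (haar I) (haar J) =
    inner (fun x => (Num.sqrt (len I))^-1 * (a - b)) (haar J).
  apply: eq_Rintegral => x _; rewrite {1}/haar -!mulrA; congr (_ * _).
  by rewrite !mulrBl Ha Hb.
rewrite inner_haar; last exact: dyadic_integrable_cst.
by rewrite /incr !avg_cst subrr mul0r mulr0.
Qed.

Lemma sqint_L2_series c : sqint (L2_series c).
Proof.
rewrite /L2_series; case: xgetP => [g _ [/Lfun_sqint //]|_]; exact: sqint0.
Qed.

(** A bound on all finite partial sums passes to the limit; the default value 0 is covered because
    the empty family gives [0 <= M]. *)
Lemma inner_L2_series_le c phi (M : R) : (forall I, sqint (c I)) -> sqint phi ->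
  (forall F : {fset dyadic}, `|\sum_(I <- F) inner (c I) phi| <= M) ->
  `|inner (L2_series c) phi| <= M.
Proof.
move=> ci sphi H; rewrite /L2_series; case: xgetP => [g _ gs|_]; last first.
  rewrite inner0l normr0; apply: le_trans (H fset0); exact: normr_ge0.
apply/ler_addgt0Pr => e e0.
have [F [_ HF]] := L2_sum_inner fset0 ci gs sphi e0.
have := ler_normD (inner g phi - \sum_(I <- F) inner (c I) phi)
  (\sum_(I <- F) inner (c I) phi).
by rewrite subrK; have := H F; lra.
Qed.

(** An inequality and not an equality, since the series may take its default value. Upper bounds on
    Haar coefficients suffice for a positive form. *)
Lemma inner_L2_series_single c phi P : (forall I, sqint (c I)) -> sqint phi ->
  (forall I, I != P -> inner (c I) phi = 0) ->
  `|inner (L2_series c) phi| <= `|inner (c P) phi|.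
Proof.
move=> ci sphi H; apply: inner_L2_series_le => // F.
have [PF|PF] := boolP (P \in (F : seq dyadic)).
  rewrite (bigD1_seq P PF (fset_uniq F)) /= big1 ?addr0 // => I IP; exact: H.
rewrite big_seq big1 ?normr0 ?normr_ge0 // => I IF; apply: H.
by apply: contraNneq PF => <-.
Qed.

Lemma parent_left I : parent (left_half I) = I.
Proof. by case: I => j k; rewrite /parent /= addrK mulKz. Qed.

Lemma parent_right I : parent (right_half I) = I.
Proof.
case: I => j k; rewrite /parent /= addrK [2 * k]mulrC divzMDl //.
by have -> : (1 %/ 2)%Z = 0 :> int by []; rewrite addr0.
Qed.

Lemma dyadic_shift_coef f J : sqint f ->
  `|inner (dyadic_shift f) (haar J)| <= `|inner f (haar (parent J))|.
Proof.
move=> sf; rewrite /dyadic_shift.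
set c := (X in L2_series X).
have ci I : sqint (c I).
  by apply: sqintZ; apply: sqintB; apply: sqint_haar.
have cJ I : inner (c I) (haar J) =
    inner f (haar I) * ((left_half I == J)%:R - (right_half I == J)%:R).
  rewrite /c innerZl ?innerBl ?inner_haar_orthonormal //;
    by [exact: sqint_haar|apply: sqintB; apply: sqint_haar].
apply: le_trans (inner_L2_series_single (P := parent J) ci (sqint_haar R J) _) _.
  move=> I IJ; have lJ : (left_half I == J) = false.
    by apply: contra_neqF IJ => /eqP <-; rewrite parent_left.
  have rJ : (right_half I == J) = false.
    by apply: contra_neqF IJ => /eqP <-; rewrite parent_right.
  by rewrite cJ lJ rJ subrr mulr0.
rewrite cJ normrM ler_piMr //.
by case: (left_half _ == J); case: (right_half _ == J);
  rewrite ?subrr ?subr0 ?sub0r ?normrN ?normr0 ?normr1.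
Qed.

Lemma paraproduct_coef b f J :
  `|inner (paraproduct b f) (haar J)| <= `|inner b (haar J) * avg f J|.
Proof.
rewrite /paraproduct; set c := (X in L2_series X).
have ci I : sqint (c I) by apply: sqintZ; exact: sqint_haar.
have cJ I : inner (c I) (haar J) = inner b (haar I) * avg f I * (I == J)%:R.
  by rewrite /c innerZl ?inner_haar_orthonormal //; exact: sqint_haar.
apply: le_trans (inner_L2_series_single (P := J) ci (sqint_haar R J) _) _.
  by move=> I /negbTE IJ; rewrite cJ IJ mulr0.
by rewrite cJ eqxx mulr1.
Qed.

End HaarSeries.

(** * The positive form on finite families *)

Section Families.
Variable R : realType.
Local Notation mu := (@lebesgue_measure R).
Local Notation len := (@dyadic_len R).
Local Notation dset := (@dyadic_set R).
Implicit Types (I J K : dyadic) (f g w s b : R -> R).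

Fixpoint tree_seq n K : seq dyadic :=
  if n is n'.+1
  then K :: tree_seq n' (left_half K) ++ tree_seq n' (right_half K)
  else [::].

Lemma tree_seq_sum (t : dyadic -> R) n K :
  \sum_(J <- tree_seq n K) len J * t J = len K * tree_sum t n K.
Proof.
elim: n K => [|n IH] K /=; first by rewrite big_nil mulr0.
rewrite big_cons big_cat /= !IH dyadic_len_left dyadic_len_right; lra.
Qed.

Lemma tree_seq_mono m n K : (m <= n)%N -> {subset tree_seq m K <= tree_seq n K}.
Proof.
elim: m n K => [//|m IH] [//|n] K /= mn J; rewrite !inE !mem_cat.
by case/or3P => [->//|/(IH _ _ mn) ->|/(IH _ _ mn) ->]; rewrite ?orbT.
Qed.

Lemma tree_seq_parent n K : {subset tree_seq n K <= tree_seq n.+1 (parent K)}.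
Proof.
move=> J; rewrite /= inE mem_cat.
by case: (parentP K) => {1}-> ->; rewrite ?orbT.
Qed.

Lemma tree_seq_ancestor n I : I \in tree_seq n.+1 (iter n parent I).
Proof.
elim: n => [|n IH]; first by rewrite inE eqxx.
by rewrite iterS; exact: tree_seq_parent.
Qed.

Lemma ancestor_gen n I : (iter n parent I).1 = I.1 - n%:Z.
Proof.
elim: n => [|n IH]; first by rewrite subr0.
by rewrite iterS /= IH intS opprD addrA addrAC.
Qed.

(** One tree is not enough: intervals on opposite sides of 0 have no common dyadic ancestor. Tops of
    a single generation [j] are disjoint, so the estimates on the trees add up to integrals over the
    line. *)
Lemma finite_family_forest (F : seq dyadic) : exists (j : int) (n : nat) (tops : seq dyadic),
  [/\ uniq tops, {in tops, forall K, K.1 = j} &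
      {subset F <= flatten [seq tree_seq n K | K <- tops]}].
Proof.
have [j jF] : exists j : int, forall I, I \in F -> j <= I.1.
  elim: F => [|I F [j jF]]; first by exists 0.
  exists (Order.min j I.1) => J; rewrite inE => /orP[/eqP->|/jF jJ].
    by rewrite ge_min lexx orbT.
  by rewrite ge_min jJ.
pose h I := `|I.1 - j|%N; pose top I := iter (h I) parent I.
have [n nF] : exists n, forall I, I \in F -> (h I < n)%N.
  elim: F {jF} => [|I F [n nF]]; first by exists 0%N.
  exists (maxn n (h I).+1) => J; rewrite inE => /orP[/eqP->|/nF nJ].
    by rewrite leq_max ltnSn orbT.
  by rewrite leq_max nJ.
exists j, n, (undup (map top F)); split.
- exact: undup_uniq.
- move=> K; rewrite mem_undup => /mapP[I IF ->].
  rewrite ancestor_gen /h gez0_abs ?subr_ge0 ?jF //.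
  by rewrite opprB addrCA subrr addr0.
- move=> I IF; apply/flatten_mapP; exists (top I).
    by rewrite mem_undup; exact: map_f.
  exact: tree_seq_mono (nF _ IF) _ (tree_seq_ancestor _ _).
Qed.

Lemma sum_same_generation (h : R -> R) (j : int) (s : seq dyadic) :
  mu.-integrable setT (EFin \o h) -> (forall x, 0 <= h x) ->
  uniq s -> {in s, forall K, K.1 = j} ->
  \sum_(K <- s) len K * avg h K <= \int[mu]_x h x.
Proof.
move=> hi h0 us sj; have hd := integrable_dyadic hi.
pose H r x := \sum_(K <- r) h x * \1_(dset K) x.
have HI r : mu.-integrable setT (EFin \o H r) /\
    \int[mu]_x H r x = \sum_(K <- r) len K * avg h K.
  elim: r => [|K r [IH1 IH2]].
    have E : H [::] = cst 0 by apply/funext => x; rewrite /H big_nil.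
    rewrite E big_nil Rintegral_cst // mul0r; split=> //.
    have := integrable0 mu (@setT R); exact: eq_integrable.
  have E : H (K :: r) = fun x => h x * \1_(dset K) x + H r x.
    by apply/funext => x; rewrite /H big_cons.
  have iK := integrable_mul_indic K hd.
  rewrite E RintegralD // IH2 Rintegral_mul_indic avgE big_cons; split=> //.
  by have := integrableD measurableT iK IH1; exact: eq_integrable.
have [H1 <-] := HI s; apply: le_Rintegral => // x _; rewrite /H.
have [[K Ks Kx]|nK] := pselect (exists2 K, K \in s & dset K x).
  rewrite (bigD1_seq K Ks us) /= big_seq_cond big1 => [|J /andP[Js JK]].
    by rewrite addr0 indicE mem_set // mulr1.
  rewrite indicE memNset ?mulr0 // => Jx.
  have JE : J.1 = K.1 by rewrite !sj.
  by move/eqP: JK; apply; exact: dyadic_set_disjoint JE Jx Kx.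
rewrite big_seq big1 // => K Ks; rewrite indicE memNset ?mulr0 // => Kx.
by apply: nK; exists K.
Qed.

Lemma ler_sum_subset (t : dyadic -> R) (s1 s2 : seq dyadic) :
  (forall I, 0 <= t I) -> uniq s1 -> {subset s1 <= s2} ->
  \sum_(I <- s1) t I <= \sum_(I <- s2) t I.
Proof.
move=> t0 u1 s12; elim: s2 s1 u1 s12 => [|K s2 IH] s1 u1 s12.
  suff -> : s1 = [::] by rewrite !big_nil.
  by case: s1 s12 {u1} => // I s1 /(_ I); rewrite inE eqxx => /(_ isT).
have sub J : J \in rem K s1 -> J \in s2.
  rewrite mem_rem_uniq // inE => /andP[JK /s12].
  by rewrite inE (negbTE JK).
have := IH _ (rem_uniq K u1) sub; rewrite big_cons.
have [Ks|Ks] := boolP (K \in s1); last by rewrite rem_id //; have := t0 K; lra.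
by move=> H; rewrite (perm_big _ (perm_to_rem Ks)) big_cons /= lerD2l.
Qed.

Section Form.
Variables (f g w s b : R -> R) (A B C : R).
Hypotheses (fi : dyadic_integrable f) (gi : dyadic_integrable g).
Hypotheses (wi : dyadic_integrable w) (si : dyadic_integrable s).
Hypothesis bi : dyadic_integrable b.
Hypotheses (w0 : forall x, 0 < w x) (sw : forall x, s x * w x = 1).
Hypothesis fwi : mu.-integrable setT (EFin \o (fun x => f x ^+ 2 * w x)).
Hypothesis gsi : mu.-integrable setT (EFin \o (fun x => g x ^+ 2 * s x)).
Hypothesis wsA : forall I, avg w I * avg s I <= A.
Hypothesis bB : forall I, avg (fun x => `|b x - avg b I|) I <= B.
Hypotheses (B0 : 0 < B) (C1 : 18 * 1440 <= C).

Definition shift_term I : R :=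
  carleson_term (avg (fun x => `|f x|)) (avg g) (avg b) I.

Lemma shift_term_ge0 I : 0 <= shift_term I.
Proof.
rewrite /shift_term /carleson_term /incr3.
by apply: mulr_ge0; [apply: mulr_ge0; [exact: avg_ge0|]|]; rewrite ?addr_ge0.
Qed.

Lemma tree_shift_term_bound n K :
  tree_sum shift_term n K <= 4 * C * A * B *
    (avg (fun x => f x ^+ 2 * w x) K + avg (fun x => g x ^+ 2 * s x) K).
Proof.
have s0 x : 0 < s x by rewrite -(pmulr_lgt0 _ (w0 x)) sw.
have ws x : w x * s x = 1 by rewrite mulrC.
have fwd := integrable_dyadic fwi; have gsd := integrable_dyadic gsi.
(* Cauchy-Schwarz for the constant function 1; positivity of both averages follows. *)
have uv1 J : 1 <= avg w J * avg s J.
  have c1 := dyadic_integrable_cst (1 : R).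
  have c2 : dyadic_integrable (fun x => cst (1 : R) x ^+ 2 * w x).
    by move: wi; congr dyadic_integrable; apply/funext => x; rewrite expr1n mul1r.
  have := avg_cauchy_schwarz J c1 c2 si w0 sw.
  congr (is_true (_ <= _)); last first.
    by congr (avg _ _ * _); apply/funext => x; rewrite /= expr1n mul1r.
  rewrite -[RHS](expr1n R 2) -[in RHS](avg_cst 1 J); congr (avg _ _ ^+ _).
  by apply/funext => x; rewrite /= normr1.
have u0 J : 0 < avg w J.
  rewrite lt_def avg_ge0 ?andbT => [|x]; last exact: ltW.
  by apply/eqP => E; have := uv1 J; rewrite E mul0r ler10.
have v0 J : 0 < avg s J.
  rewrite lt_def avg_ge0 ?andbT => [|x]; last exact: ltW.
  by apply/eqP => E; have := uv1 J; rewrite E mulr0 ler10.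
apply: (@tree_sum_bound _ _ _ (avg s) (avg (fun x => `|g x|)) _ (avg w) _ _
  (fun a => avg (fun x => `|b x - a|))) => //.
- exact/avg_martingale/dyadic_integrable_norm.
- exact: avg_martingale.
- exact: avg_martingale.
- exact/avg_martingale/dyadic_integrable_norm.
- exact: avg_martingale.
- exact: avg_martingale.
- exact: avg_martingale.
- exact: avg_martingale.
- move=> a; apply/avg_martingale/dyadic_integrable_norm/dyadic_integrableB => //.
  exact: dyadic_integrable_cst.
- by move=> J; apply: avg_ge0.
- by move=> J; exact: ler_norm_avg.
- by move=> J; exact: avg_cauchy_schwarz.
- by move=> J; exact: avg_cauchy_schwarz.
- by move=> a J; exact: ler_dist_avg.
Qed.

Lemma shift_family_bound (F : seq dyadic) : uniq F ->
  \sum_(I <- F) len I * shift_term I <= 4 * C * A * B *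
    (\int[mu]_x (f x ^+ 2 * w x) + \int[mu]_x (g x ^+ 2 * s x)).
Proof.
move=> uF; have s0 x : 0 < s x by rewrite -(pmulr_lgt0 _ (w0 x)) sw.
have [j [n [tops [utops jtops Ftops]]]] := finite_family_forest F.
have t0 I : 0 <= len I * shift_term I.
  by rewrite mulr_ge0 ?shift_term_ge0 // ltW // dyadic_len_gt0.
apply: (le_trans (ler_sum_subset t0 uF Ftops)).
rewrite big_flatten big_map.
have A0 : 0 <= A.
  by apply: le_trans (wsA (0, 0)); rewrite mulr_ge0 // avg_ge0 // => x; exact: ltW.
have C0 : 0 <= C by have := C1; lra.
have CAB0 : 0 <= 4 * C * A * B by rewrite !mulr_ge0 // ltW.
apply: (@le_trans _ _ (\sum_(K <- tops) 4 * C * A * B *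
    (len K * avg (fun x => f x ^+ 2 * w x) K +
     len K * avg (fun x => g x ^+ 2 * s x) K))).
  apply: ler_sum => K _; rewrite tree_seq_sum -mulrDr mulrCA.
  by rewrite ler_wpM2l ?tree_shift_term_bound // ltW // dyadic_len_gt0.
rewrite -mulr_sumr big_split /= ler_wpM2l //.
by apply: lerD; apply: sum_same_generation utops jtops => // x;
  rewrite mulr_ge0 ?sqr_ge0 // ltW.
Qed.

End Form.
End Families.

(** * Duality in L^2(w) *)

Section Duality.
Variable R : realType.
Local Notation mu := (@lebesgue_measure R).
Implicit Types (f g h w s phi : R -> R).

Lemma integrable_bounded_mul_indic h (E : set R) (M : R) :
  measurable (E : set (measurableTypeR R)) -> (mu E < +oo)%E ->
  measurable_fun [set: R] h -> (forall x, E x -> `|h x| <= M) ->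
  mu.-integrable setT (EFin \o (fun x => h x * \1_E x)).
Proof.
move=> mE Ey mh hM.
have hE : mu.-integrable E (EFin \o h).
  apply: measurable_bounded_integrable => //; first exact: measurable_funS mh.
  exists M; split; first exact: num_real.
  by move=> y My x Ex /=; apply: le_trans (hM x Ex) (ltW My).
have /(integrable_mkcond _ mE) := hE.
apply: eq_integrable => // x _ /=; rewrite patchE indicE.
by case: ifP => _; rewrite ?mulr1 ?mulr0.
Qed.

(** The hypothesis is inhomogeneous because the form is bounded by a sum of two energies, that of
    [f] being normalised to 1. Homogeneity is recovered by scaling the test function by [t]. *)
Lemma wnorm_le_dual w s g (K : R) :
  measurable_fun [set: R] w -> (forall x, 0 < w x) -> (forall x, s x * w x = 1) ->
  sqint g ->
  (forall phi, sqint phi ->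
    mu.-integrable setT (EFin \o (fun x => phi x ^+ 2 * s x)) ->
    `|inner g phi| <= K * (1 + \int[mu]_x (phi x ^+ 2 * s x))) ->
  (wnorm w g <= (2 * K)%:E)%E.
Proof.
move=> mw w0 sw [mg gi] H.
(* Finiteness of the weighted norm of [g] is not known beforehand. On [E n] all quantities are
   bounded, and monotone convergence removes the truncation. *)
pose E (n : nat) : set (measurableTypeR R) :=
  `[- n%:R, n%:R]%classic `&` ((fun x => w x) @^-1` `]-oo, n%:R] `&`
   (fun x => `|g x|) @^-1` `]-oo, n%:R]).
have EP n x : E n x <-> [/\ `|x| <= n%:R, w x <= n%:R & `|g x| <= n%:R].
  rewrite /E /setI /= !in_itv /= (ler_norml x); split => [[a [b c]]|[a b c]] //.
have mE n : measurable (E n).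
  apply: measurableI; first exact: measurable_itv.
  apply: measurableI; rewrite -[X in measurable X]setTI.
    by apply: mw.
  have mng : measurable_fun [set: R] (fun x => `|g x|) by exact: measurableT_comp.
  by apply: mng.
have Ey n : (mu (E n) < +oo)%E.
  apply: (@le_lt_trans _ _ (mu (`[- n%:R, n%:R]%classic : set R))).
    by apply: le_measure; rewrite ?inE //=; exact: subIsetl. 
  by rewrite [X in (X < _)%E]lebesgue_measure_itv /=; case: ifP => _; rewrite -?EFinB ltry.
pose G := (fun x => g x ^+ 2 * w x) : R -> R.
have mG : measurable_fun [set: R] G.
  by apply: measurable_funM => //; exact: measurable_funX.
have G0 x : 0 <= G x by rewrite mulr_ge0 ?sqr_ge0 // ltW.
have GE n x : E n x -> `|G x| <= n%:R ^+ 3.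
  move=> /EP[_ wn gn]; rewrite ger0_norm // /G -(real_normK (num_real (g x))) [n%:R ^+ 3]exprSr.
  by apply: ler_pM; rewrite ?sqr_ge0 ?(ltW (w0 x)) // lerXn2r ?nnegrE.
pose S n := \int[mu]_x (G x * \1_(E n) x).
have iG n := integrable_bounded_mul_indic (mE n) (Ey n) mG (GE n).
have S0 n : 0 <= S n by apply: Rintegral_ge0 => x _; rewrite mulr_ge0.
have KS n (t : R) : 0 < t -> t * S n <= K * (1 + t ^+ 2 * S n).
  move=> t0.
  (* the extremiser of the duality, truncated to a set where it is bounded *)
  pose phi := (fun x => t * (g x * w x * \1_(E n) x)) : R -> R.
  have ind x : (\1_(E n) x : R) ^+ 2 = \1_(E n) x.
    by rewrite indicE; case: (_ \in _); rewrite ?expr1n ?expr0n.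
  have mgw : measurable_fun [set: R] (fun x => g x * w x) by exact: measurable_funM.
  have sphi : sqint phi.
    apply: sqintZ; split.
      by apply: measurable_funM => //; apply: measurable_indic; exact: mE.
    have mgw2 : measurable_fun [set: R] (fun x => (g x * w x) ^+ 2).
      exact: measurable_funX.
    have bnd x : E n x -> `|(g x * w x) ^+ 2| <= (n%:R * n%:R) ^+ 2.
      move=> /EP[_ wn gn]; rewrite normrX normrM (gtr0_norm (w0 x)).
      rewrite lerXn2r ?nnegrE ?mulr_ge0 ?(ltW (w0 x)) //.
      by apply: ler_pM; rewrite ?(ltW (w0 x)).
    have := integrable_bounded_mul_indic (mE n) (Ey n) mgw2 bnd.
    by apply: eq_integrable => // x _ /=; rewrite [in RHS]exprMn ind.
  have phis x : phi x ^+ 2 * s x = t ^+ 2 * (G x * \1_(E n) x).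
    rewrite /phi exprMn exprMn ind /G; have := sw x.
    move: (\1_(E n) x) (s x) (w x) (g x) => i s' w' g' E1.
    transitivity (t ^+ 2 * (g' ^+ 2 * w' * i) * (s' * w')); first by ring.
    by rewrite E1 mulr1.
  have phii : mu.-integrable setT (EFin \o (fun x => phi x ^+ 2 * s x)).
    have := integrableZl measurableT (t ^+ 2) (iG n).
    by apply: eq_integrable => // x _ /=; rewrite phis.
  have := H phi sphi phii.
  have -> : inner g phi = t * S n.
    rewrite /S -RintegralZl //; apply: eq_Rintegral => x _.
    rewrite /phi /G; ring.
  have -> : \int[mu]_x (phi x ^+ 2 * s x) = t ^+ 2 * S n.
    by rewrite /S -RintegralZl //; apply: eq_Rintegral => x _; exact: phis.
  by rewrite ger0_norm // mulr_ge0 // ltW.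
have K0 : 0 <= K.
  have := KS 0%N 1 ltr01; rewrite expr1n !mul1r => h.
  rewrite -(@pmulr_lge0 _ (1 + S 0%N)); first exact: le_trans h.
  by have := S0 0%N; lra.
have SK n : S n <= (2 * K) ^+ 2.
  have [K1|K1] := eqVneq K 0.
    by have := KS n 1 ltr01; rewrite K1 mul0r mulr0 expr0n mul1r.
  have Kp : 0 < K by rewrite lt_def K1.
  have K2 : 0 < 2 * K by rewrite mulr_gt0.
  (* With [t = 1 / (2 K)] the term [K t^2 S n] absorbs half of [t S n]. *)
  have := KS n (2 * K)^-1; rewrite invr_gt0 => /(_ K2) h.
  have : 2 * S n <= 4 * K ^+ 2 + S n.
    have := ler_wpM2l (ltW (mulr_gt0 K2 K2)) h.
    have -> : 2 * K * (2 * K) * ((2 * K)^-1 * S n) = K * (2 * S n).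
      by field; rewrite gt_eqF.
    have -> : 2 * K * (2 * K) * (K * (1 + (2 * K)^-1 ^+ 2 * S n)) =
      K * (4 * K ^+ 2 + S n) by field; rewrite gt_eqF.
    by rewrite ler_pM2l.
  by lra.
have ndE : nondecreasing_seq E.
  apply/nondecreasing_seqP => n; apply/subsetPset => x /EP[a b c].
  have nn : (n%:R : R) <= n.+1%:R by rewrite ler_nat.
  by apply/EP; split; [exact: le_trans a nn|exact: le_trans b nn|exact: le_trans c nn].
have cupE : \bigcup_n E n = setT.
  apply/seteqP; split=> // x _.
  have [n nx] : exists n : nat, `|x| + w x + `|g x| <= n%:R.
    exists (Num.trunc (`|x| + w x + `|g x|)).+1; apply/ltW/truncnS_gt.
  exists n => //; apply/EP; have := normr_ge0 x; have := normr_ge0 (g x).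
  by have := w0 x; split; lra.
have cv : (\int[mu]_(x in E n) (G x)%:E @[n --> \oo] -->
    \int[mu]_(x in \bigcup_n E n) (G x)%:E)%E.
  apply: ge0_nondecreasing_set_cvg_integral => //.
    by move=> n; apply/measurable_EFinP; exact: measurable_funS mG.
  by move=> n x _; rewrite lee_fin.
have le n : (\int[mu]_(x in E n) (G x)%:E <= ((2 * K) ^+ 2)%:E)%E.
  rewrite integral_mkcond.
  have -> : ((fun x => (G x)%:E) \_ (E n)) = EFin \o (fun x => G x * \1_(E n) x).
    apply/funext => x /=; rewrite patchE indicE.
    by case: ifP => _; rewrite ?mulr1 ?mulr0.
  rewrite -(fineK (integrable_fin_num measurableT (iG n))) lee_fin; exact: SK.
have tot : (\int[mu]_x (G x)%:E <= ((2 * K) ^+ 2)%:E)%E.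
  rewrite -cupE -(cvg_lim _ cv) //; apply: lime_le; first by apply/cvg_ex; eexists; exact: cv.
  by apply: nearW.
rewrite /wnorm.
have -> : (\int[mu]_x (`|g x| ^+ 2 * w x)%:E = \int[mu]_x (G x)%:E)%E.
  by apply: eq_integral => x _; rewrite real_normK ?num_real.
have -> : ((2 * K)%:E = ((2 * K) ^+ 2)%:E `^ 2^-1)%E.
  by rewrite poweR_EFin -powR_mulrn ?mulr_ge0 // -powRrM mulfV // powRr1 ?mulr_ge0.
apply: gt0_ler_poweR => //.
  by rewrite in_itv /= leey andbT integral_ge0 // => x _; rewrite lee_fin.
by rewrite in_itv /= leey andbT lee_fin sqr_ge0.
Qed.

End Duality.

(** * The two compositions for everywhere positive weights *)

Section Products.
Variable R : realFieldType.
Implicit Types (p x y z t u v : R).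

(** Here [l], [sl], [sr] are the roots of the lengths of [I] and its halves, [c] is a Haar
    coefficient of [pi_b f], [a] and [p] are [|<f>_I|] and [<|f|>_I]; [x, y, z] and [t, u, v] are
    the increments of [b] and of the test function at [I] and its halves. *)
Lemma ler_haar_product (l sl sr c a p x y z t u v : R) :
  0 <= sl -> sl <= l -> 0 <= sr -> sr <= l -> 0 <= c -> c <= l * x * a ->
  0 <= a -> a <= p -> 0 <= x -> 0 <= y -> 0 <= z -> 0 <= t -> 0 <= u -> 0 <= v ->
  c * (sl * u + sr * v) <= l ^+ 2 * (p * (x + y + z) * (t + u + v)).
Proof.
move=> sl0 sll sr0 srl c0 cle a0 ap x0 y0 z0 t0 u0 v0.
have l0 := le_trans sl0 sll; have p0 := le_trans a0 ap.
apply: (@le_trans _ _ (l * x * p * (l * (u + v)))).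
  apply: ler_pM => //.
  - by rewrite addr_ge0 // mulr_ge0.
  - by apply: le_trans cle _; rewrite ler_wpM2l // mulr_ge0.
  - by rewrite mulrDr lerD // ler_wpM2r.
have -> : l * x * p * (l * (u + v)) = l ^+ 2 * (p * x * (u + v)) by ring.
rewrite ler_wpM2l ?sqr_ge0 //; apply: ler_pM; rewrite ?mulr_ge0 ?addr_ge0 //.
  by rewrite ler_wpM2l // -addrA lerDl addr_ge0.
by rewrite -addrA lerDr.
Qed.

Lemma ler_triple_product p x y z t u v :
  0 <= p -> 0 <= x -> 0 <= y -> 0 <= z -> 0 <= t -> 0 <= u -> 0 <= v ->
  p * (y + z) * t <= p * (x + y + z) * (t + u + v).
Proof.
move=> p0 x0 y0 z0 t0 u0 v0; apply: ler_pM; rewrite ?mulr_ge0 ?addr_ge0 //.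
  by rewrite ler_wpM2l // -addrA lerDr.
by rewrite -addrA lerDl addr_ge0.
Qed.

End Products.

Section Core.
Variable R : realType.
Local Notation mu := (@lebesgue_measure R).
Local Notation len := (@dyadic_len R).
Local Notation dset := (@dyadic_set R).
Implicit Types (I J K : dyadic) (g phi : R -> R).
Variables (w s b : R -> R) (A B C : R).
Hypotheses (mw : measurable_fun [set: R] w).
Hypotheses (wi : dyadic_integrable w) (si : dyadic_integrable s).
Hypothesis bi : dyadic_integrable b.
Hypotheses (w0 : forall x, 0 < w x) (sw : forall x, s x * w x = 1).
Hypothesis wsA : forall I, avg w I * avg s I <= A.
Hypothesis bB : forall I, avg (fun x => `|b x - avg b I|) I <= B.
Hypotheses (B0 : 0 < B) (C1 : 18 * 1440 <= C).
Variable f : R -> R.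
Hypothesis sf : sqint f.
Hypothesis fwi : mu.-integrable setT (EFin \o (fun x => f x ^+ 2 * w x)).
Hypothesis fw1 : \int[mu]_x (f x ^+ 2 * w x) <= 1.

Lemma inner_haarE g I : sqint g ->
  `|inner g (haar I)| = Num.sqrt (len I) * `|incr (avg g) I|.
Proof.
move=> sg; rewrite inner_haar; last exact: sqint_dyadic.
by rewrite normrM ger0_norm // sqrtr_ge0.
Qed.

Lemma inner_haar_bE I :
  `|inner b (haar I)| = Num.sqrt (len I) * `|incr (avg b) I|.
Proof. by rewrite inner_haar // normrM ger0_norm // sqrtr_ge0. Qed.

Lemma sqrt_len_half I J : J.1 = I.1 + 1 -> Num.sqrt (len J) <= Num.sqrt (len I).
Proof.
move=> JI; apply: ler_wsqrtr; rewrite (dyadic_len_half R JI).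
by have := dyadic_len_gt0 R I; lra.
Qed.

Lemma core_A_ge0 : 0 <= A.
Proof.
apply: le_trans (wsA (0, 0)); rewrite mulr_ge0 // avg_ge0 // => x; first exact: ltW.
by rewrite ltW // -(pmulr_lgt0 _ (w0 x)) sw.
Qed.

Lemma shift_paraproduct_term phi I : sqint phi ->
  `|inner (paraproduct b f) (haar I)| *
    (`|inner phi (haar (left_half I))| + `|inner phi (haar (right_half I))|)
  <= len I * shift_term f phi b I.
Proof.
move=> sphi; have := paraproduct_coef b f I.
rewrite normrM inner_haar_bE !(@inner_haarE phi _ sphi) => le_c.
have := ler_haar_product (sqrtr_ge0 _) (@sqrt_len_half I (left_half I) erefl)
  (sqrtr_ge0 _) (@sqrt_len_half I (right_half I) erefl) (normr_ge0 _) le_c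
  (normr_ge0 _) (ler_norm_avg I (sqint_dyadic sf)) (normr_ge0 _)
  (normr_ge0 (incr (avg b) (left_half I))) (normr_ge0 (incr (avg b) (right_half I)))
  (normr_ge0 (incr (avg phi) I)) (normr_ge0 (incr (avg phi) (left_half I)))
  (normr_ge0 (incr (avg phi) (right_half I))).
by rewrite sqr_sqrtr // ltW // dyadic_len_gt0.
Qed.

Lemma shift_paraproduct_bound :
  (wnorm w (dyadic_shift (paraproduct b f)) <=
   (2 * (4 * C * A * B))%:E)%E.
Proof.
apply: (@wnorm_le_dual _ w s) => //; first exact: sqint_L2_series.
move=> phi sphi phis; rewrite /dyadic_shift; set h := paraproduct b f.
set c := (X in L2_series X).
have ci I : sqint (c I) by apply: sqintZ; apply: sqintB; apply: sqint_haar.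
apply: inner_L2_series_le => // F.
apply: (le_trans (ler_norm_sum _ _ _)).
apply: (@le_trans _ _ (\sum_(I <- F) len I * shift_term f phi b I)).
  apply: ler_sum => I _; apply: le_trans (shift_paraproduct_term I sphi).
  rewrite /c innerZl ?innerBl //; try (by apply: sqint_haar);
    try (by apply: sqintB; apply: sqint_haar).
  rewrite normrM ler_wpM2l // (le_trans (ler_normB _ _)) //.
  by rewrite !(innerC (haar _)).
apply: (le_trans (shift_family_bound (sqint_dyadic sf) (sqint_dyadic sphi)
  wi si bi w0 sw fwi phis wsA bB B0 C1 (fset_uniq F))).
rewrite ler_wpM2l ?lerD2r // !mulr_ge0 ?core_A_ge0 ?(ltW B0) //; have := C1; lra.
Qed.

(** The average of [|phi|] is taken over a half [J], whereas the form uses [I]; this move costs the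
    factor 2. *)
Lemma adj_shift_term phi I : sqint phi ->
  (forall J, J = left_half I \/ J = right_half I ->
    `|inner b (haar J)| * `|inner f (haar I)| * avg (fun x => `|phi x|) J <=
    len I * (2 * avg (fun x => `|phi x|) I * `|incr (avg b) J| * `|incr (avg f) I|)).
Proof.
move=> sphi J JI; rewrite inner_haar_bE !inner_haarE //.
have nphi := dyadic_integrable_norm (sqint_dyadic sphi).
have pJ0 : 0 <= avg (fun x => `|phi x|) J by exact: avg_ge0.
have pI : avg (fun x => `|phi x|) J <= 2 * avg (fun x => `|phi x|) I.
  have [] := nneg_kids I (avg_martingale nphi) (fun K => avg_ge0 K (fun x => normr_ge0 (phi x))).
  by case: JI => ->.
have sJ : Num.sqrt (len J) <= Num.sqrt (len I).
  by apply: sqrt_len_half; case: JI => ->.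
have El := sqr_sqrtr (ltW (dyadic_len_gt0 R I)).
move: pJ0 pI sJ El (sqrtr_ge0 (len I)) (sqrtr_ge0 (len J)).
move: (normr_ge0 (incr (avg b) J)) (normr_ge0 (incr (avg f) I)).
move: (Num.sqrt (len I)) (Num.sqrt (len J)) (`|incr (avg b) J| : R)
  (`|incr (avg f) I| : R) (avg (fun x => `|phi x|) J) (avg (fun x => `|phi x|) I).
move=> l l' x y p q x0 y0 p0 pq ll El l0 l'0.
have -> : len I * (2 * q * x * y) = (l * x) * (l * y) * (2 * q) by rewrite -El; ring.
apply: ler_pM => //; first by rewrite !mulr_ge0.
by rewrite ler_wpM2r ?mulr_ge0 // ler_wpM2r.
Qed.

Lemma inner_haar_sqr phi J : sqint phi ->
  inner (fun x => haar J x ^+ 2) phi = avg phi J.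
Proof.
move=> sphi; rewrite /avg -Rintegral_mul_indic -RintegralZl //; last first.
  by apply: integrable_mul_indic; exact: sqint_dyadic.
apply: eq_Rintegral => x _; rewrite haar_sqr; ring.
Qed.

(** Pairing with [phi] gives the sum of [<b, h_J> <S f, h_J> <phi>_J]: now [phi] is averaged and [f]
    contributes increments. It is the same form with [f] and [phi], and [w] and [1/w], exchanged,
    and the [A_2] condition is symmetric. *)
Lemma adj_shift_bound :
  (wnorm w (paraproduct_adj b (dyadic_shift f)) <=
   (2 * (2 * (4 * C * A * B)))%:E)%E.
Proof.
have s0 x : 0 < s x by rewrite -(pmulr_lgt0 _ (w0 x)) sw.
have ws x : w x * s x = 1 by rewrite mulrC.
have swA I : avg s I * avg w I <= A by rewrite mulrC.
apply: (@wnorm_le_dual _ w s) => //; first exact: sqint_L2_series.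
move=> phi sphi phis; rewrite /paraproduct_adj; set h := dyadic_shift f.
set c := (X in L2_series X).
have ci I : sqint (c I) by apply: sqintZ; exact: sqint_haar_sqr.
apply: inner_L2_series_le => // F.
apply: (le_trans (ler_norm_sum _ _ _)).
pose tau J := `|inner b (haar J)| * `|inner f (haar (parent J))| *
  avg (fun x => `|phi x|) J.
have tau0 J : 0 <= tau J by apply: mulr_ge0; [exact: mulr_ge0|exact: avg_ge0].
apply: (@le_trans _ _ (\sum_(J <- F) tau J)).
  apply: ler_sum => J _.
  rewrite /c innerZl //; last exact: sqint_haar_sqr.
  rewrite inner_haar_sqr // normrM (normrM (inner b _)); apply: ler_pM => //.
  - by apply: ler_pM => //; exact: dyadic_shift_coef.
  - by apply: ler_norm_avg; exact: sqint_dyadic.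
(* The shift moves the coefficient of [f] to the parent, so the sum is regrouped by parents; adding
   missing siblings is harmless as the terms are nonnegative. *)
pose F' := undup (map parent F).
have FF' : {subset (F : seq dyadic) <=
    flatten [seq [:: left_half K; right_half K] | K <- F']}.
  move=> J JF; apply/flatten_mapP; exists (parent J).
    by rewrite mem_undup map_f.
  by rewrite !inE; case: (parentP J) => <-; rewrite eqxx ?orbT.
apply: (le_trans (ler_sum_subset tau0 (fset_uniq F) FF')).
rewrite big_flatten big_map.
apply: (@le_trans _ _ (2 * \sum_(K <- F') len K * shift_term phi f b K)).
  rewrite mulr_sumr; apply: ler_sum => K _; rewrite !big_cons big_nil /= addr0.
  have tl := @adj_shift_term phi K sphi (left_half K) (or_introl erefl).
  have tr := @adj_shift_term phi K sphi (right_half K) (or_intror erefl).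
  rewrite {1 2}/tau parent_left parent_right.
  apply: (le_trans (lerD tl tr)).
  rewrite -mulrDr [leRHS]mulrCA ler_wpM2l ?(ltW (dyadic_len_gt0 R K)) //.
  rewrite /shift_term /carleson_term /incr3.
  have p0 : 0 <= avg (fun x => `|phi x|) K by exact: avg_ge0.
  apply: le_trans (ler_wpM2l (ler0n R 2) (ler_triple_product p0 _ _ _ _ _ _)) => //.
  by rewrite -!mulrDl -!mulrA -!mulrDr !mulrA.
rewrite -mulrA ler_pM2l //.
apply: (le_trans (shift_family_bound (sqint_dyadic sphi) (sqint_dyadic sf)
  si wi bi s0 ws phis fwi swA bB B0 C1 (undup_uniq _))).
rewrite [1 + _]addrC ler_wpM2l ?lerD2l // !mulr_ge0 ?core_A_ge0 ?(ltW B0) //; have := C1; lra.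
Qed.

End Core.

(** * General weights *)

Section Weights.
Variable R : realType.
Local Notation mu := (@lebesgue_measure R).
Local Notation len := (@dyadic_len R).
Local Notation dset := (@dyadic_set R).
Implicit Types (I : dyadic) (w b f g h : R -> R).

Lemma eavgE f I : dyadic_integrable f -> eavg f I = (avg f I)%:E.
Proof.
move=> fi; rewrite /eavg /avg EFinM /Rintegral fineK //.
exact: integrable_fin_num.
Qed.

(** Writing the inverse as [h] times the inverse of its square reduces it to a real power of a
    nonnegative function and gives 0 where [h] vanishes. *)
Lemma measurable_fun_invr h : measurable_fun [set: R] h ->
  measurable_fun [set: R] (fun x => (h x)^-1).
Proof.
move=> mh; have -> : (fun x => (h x)^-1) = (fun x => h x * (h x ^+ 2) `^ (-1)).
  apply/funext => x; rewrite powR_inv1 ?sqr_ge0 //.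
  have [->|h0] := eqVneq (h x) 0; first by rewrite invr0 mul0r.
  by rewrite expr2 invfM mulrA mulfV // mul1r.
apply: measurable_funM => //.
apply: (measurableT_comp (measurable_powR _)) => //.
exact: measurable_funX.
Qed.

Section Regularization.
Variable w : R -> R.
Hypotheses (mw : measurable_fun [set: R] w) (wpos : {ae mu, forall x, 0 < w x}).

(* [w] is positive only almost everywhere, and [x^-1 = 0] at [x = 0]. *)
Definition positive_weight x : R := if 0 < w x then w x else 1.
Local Notation w' := positive_weight.

Lemma positive_weight_gt0 x : 0 < w' x.
Proof. by rewrite /w'; case: ifP. Qed.

Lemma measurable_positive_weight : measurable_fun [set: R] w'.
Proof.
apply: measurable_fun_ifT => //.
by apply: measurable_fun_ltr => //; exact: measurable_cst.
Qed.

Lemma positive_weight_integral (D : set (measurableTypeR R)) (h1 h2 : R -> R) :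
  measurable D -> measurable_fun [set: R] h1 -> measurable_fun [set: R] h2 ->
  (forall x, w' x = w x -> h1 x = h2 x) ->
  (\int[mu]_(x in D) (h1 x)%:E = \int[mu]_(x in D) (h2 x)%:E)%E.
Proof.
move=> mD m1 m2 h12; apply: ae_eq_integral => //.
- by apply/measurable_EFinP; exact: measurable_funS m1.
- by apply/measurable_EFinP; exact: measurable_funS m2.
apply: (negligibleS _ wpos) => x /=; apply: contra_not => wx _; by rewrite h12 // /w' wx.
Qed.

Lemma wnorm_positive_weight g : measurable_fun [set: R] g -> wnorm w g = wnorm w' g.
Proof.
move=> mg; rewrite /wnorm; congr (_ `^ _)%E.
have mg2 : measurable_fun [set: R] (fun x => `|g x| ^+ 2).
  by apply: measurable_funX; exact: measurableT_comp.
apply: positive_weight_integral => //.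
- exact: measurable_funM.
- by apply: measurable_funM => //; exact: measurable_positive_weight.
- by move=> x ->.
Qed.

Lemma eavg_positive_weight I : eavg w I = eavg w' I.
Proof.
rewrite /eavg; congr (_ * _)%E; apply: positive_weight_integral => //.
exact: measurable_positive_weight.
Qed.

Lemma eavg_positive_weightV I :
  eavg (fun x => (w x)^-1) I = eavg (fun x => (w' x)^-1) I.
Proof.
rewrite /eavg; congr (_ * _)%E; apply: positive_weight_integral => //.
- exact: measurable_fun_invr.
- by apply: measurable_fun_invr; exact: measurable_positive_weight.
- by move=> x ->.
Qed.

Lemma positive_weight_dyadic : dyadic_integrable w -> dyadic_integrable w'.
Proof.
move=> wi I; have mw' := measurable_positive_weight.
apply/integrableP; split; first by apply/measurable_EFinP; exact: measurable_funS mw'.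
have /integrableP[_] := wi I; apply: le_lt_trans.
suff -> : (\int[mu]_(x in dset I) `|(EFin \o w') x| =
  \int[mu]_(x in dset I) `|(EFin \o w) x|)%E by [].
apply: (@positive_weight_integral _ (fun x => `|w' x|) (fun x => `|w x|)) => //.
- exact: measurableT_comp.
- exact: measurableT_comp.
- by move=> x ->.
Qed.

End Regularization.

Lemma avg_gt0 h I : dyadic_integrable h -> (forall x, 0 < h x) -> 0 < avg h I.
Proof.
move=> hi h0; rewrite lt_def avg_ge0 ?andbT => [|x]; last exact: ltW.
apply/eqP => E.
have H : (\int[mu]_(x in dset I) `|(EFin \o h) x| = 0)%E.
  transitivity (\int[mu]_(x in dset I) (EFin \o h) x)%E.
    by apply: eq_integral => x _; rewrite /= gtr0_norm.
  rewrite -(fineK (integrable_fin_num _ (hi I))) //; congr EFin.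
  by have := avgE h I; rewrite E mulr0.
have mh : measurable_fun (dset I) (EFin \o h) by case/integrableP: (hi I).
have [N [mN N0 sub]] := (ae_eq_integral_abs mu (@measurable_dyadic_set R I) mh).1 H.
have IN : dset I `<=` N.
  move=> x Ix; apply: sub => /= /(_ Ix) [] hx.
  by have := h0 x; rewrite hx ltxx.
have : (mu (dset I) <= mu N)%E by apply: le_measure; rewrite ?inE.
rewrite N0 [X in (X <= _)%E]lebesgue_dyadic_set lee_fin leNgt.
by rewrite dyadic_len_gt0.
Qed.

(** If [1/w'] had infinite integral over some interval, its product with the positive average of
    [w'] there would be infinite, against [A2d_char w < +oo]. *)
Lemma A2d_avg w I : weight w -> (A2d_char w < +oo)%E ->
  let w' := positive_weight w in
  dyadic_integrable (fun x => (w' x)^-1) /\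
  avg w' I * avg (fun x => (w' x)^-1) I <= fine (A2d_char w).
Proof.
move=> [lw wpos] Ay w'; have [mw _ _] := lw.
have w0 x : 0 < w' x by exact: positive_weight_gt0.
have mw' : measurable_fun [set: R] w' by exact: measurable_positive_weight.
have wi : dyadic_integrable w'.
  by apply: positive_weight_dyadic => //; exact: locally_integrable_dyadic.
have mV : measurable_fun [set: R] (fun x => (w' x)^-1) by exact: measurable_fun_invr.
have V0 x : 0 < (w' x)^-1 by rewrite invr_gt0.
have HA J : ((avg w' J)%:E * eavg (fun x => ((w' x)^-1)%R) J <= A2d_char w)%E.
  rewrite -eavgE // -eavg_positive_weightV // -eavg_positive_weight //.
  by apply: ereal_sup_ubound; exists J.
have si : dyadic_integrable (fun x => (w' x)^-1).
  move=> J; apply/integrableP; split.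
    by apply/measurable_EFinP; exact: measurable_funS mV.
  have -> : (\int[mu]_(x in dset J) `|(EFin \o (fun x => ((w' x)^-1)%R)) x| =
     \int[mu]_(x in dset J) ((w' x)^-1)%R%:E)%E.
    by apply: eq_integral => x _; rewrite /= gtr0_norm.
  rewrite ltNge leye_eq; apply/negP => /eqP E.
  have := le_lt_trans (HA J) Ay; rewrite /eavg E.
  rewrite gt0_muley ?lte_fin ?invr_gt0 ?dyadic_len_gt0 //.
  by rewrite gt0_muley ?lte_fin ?avg_gt0.
have HI : ((avg w' I * avg (fun x => ((w' x)^-1)%R) I)%:E <= A2d_char w)%E.
  by rewrite EFinM -[X in (_ * X)%E]eavgE.
split=> //; rewrite -lee_fin fineK // ge0_fin_numE //; apply: le_trans HI.
by rewrite lee_fin mulr_ge0 // ltW // avg_gt0.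
Qed.

Lemma BMOd_avg b I : locally_integrable setT b -> (BMOd_norm b < +oo)%E ->
  avg (fun x => `|b x - avg b I|) I <= fine (BMOd_norm b).
Proof.
move=> /locally_integrable_dyadic bi By.
have di J : dyadic_integrable (fun x => `|b x - avg b J|).
  apply/dyadic_integrable_norm/dyadic_integrableB => //.
  exact: dyadic_integrable_cst.
have HB J : ((avg (fun x => `|b x - avg b J|) J)%:E <= BMOd_norm b)%E.
  by rewrite -eavgE //; apply: ereal_sup_ubound; exists J.
rewrite -lee_fin fineK // ge0_fin_numE //; apply: le_trans (HB I).
by rewrite lee_fin avg_ge0.
Qed.

Lemma wnorm_le1_integrable w f : measurable_fun [set: R] w -> (forall x, 0 < w x) ->
  measurable_fun [set: R] f -> (wnorm w f <= 1)%E ->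
  mu.-integrable setT (EFin \o (fun x => f x ^+ 2 * w x)) /\
  \int[mu]_x (f x ^+ 2 * w x) <= 1.
Proof.
move=> mw w0 mf; rewrite /wnorm => H.
have g0 x : 0 <= f x ^+ 2 * w x by rewrite mulr_ge0 ?sqr_ge0 // ltW.
have I0 : (0 <= \int[mu]_x (f x ^+ 2 * w x)%:E)%E.
  by apply: integral_ge0 => x _; rewrite lee_fin.
have le1 : (\int[mu]_x (f x ^+ 2 * w x)%:E <= 1)%E.
  move: H; under eq_integral do rewrite real_normK ?num_real //.
  move: (\int[mu]_x _)%E I0 => -[r| |] //=.
  - rewrite !lee_fin => r0 H; have := ge0_ler_powR (ler0n R 2) _ _ H.
    rewrite !nnegrE powR_ge0 ler01 powR1 -powRrM mulVf // powRr1 //; exact.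
  - by rewrite gt_eqF ?invr_gt0 // leye_eq.
have fin : (\int[mu]_x (f x ^+ 2 * w x)%:E < +oo)%E by apply: le_lt_trans le1 (ltry _).
split; last by rewrite -lee_fin /Rintegral fineK // ge0_fin_numE.
apply/integrableP; split.
  by apply/measurable_EFinP/measurable_funM => //; exact: measurable_funX.
suff -> : (\int[mu]_x `|(EFin \o (fun x => f x ^+ 2 * w x)%R) x| =
  \int[mu]_x (f x ^+ 2 * w x)%:E)%E by [].
by apply: eq_integral => x _; rewrite /= ger0_norm.
Qed.

End Weights.

Theorem theorem1p6 (R : realType) :
  exists C : R, forall w b : R -> R, A2d w -> BMOd b ->
    (wopnorm w (paraproduct_adj b \o @dyadic_shift R) +
     wopnorm w (@dyadic_shift R \o paraproduct b)
       <= C%:E * A2d_char w * BMOd_norm b)%E.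
Proof.
have [C C1] : exists C : R, 18 * 1440 <= C by exists (18 * 1440).
(* [24 = 2 * 2 * 4 + 2 * 4]: 4 from the tree estimate, 2 from duality, and for [pi_b^* S] another 2
   for passing to the parent. *)
exists (24 * C) => w b [ww Ay] [lb By].
have [lw wpos] := ww; have [mw _ _] := lw.
pose w' := positive_weight w; pose s x := (w' x)^-1.
have w0 x : 0 < w' x by exact: positive_weight_gt0.
have sw x : s x * w' x = 1 by rewrite mulVf // gt_eqF.
have mw' : measurable_fun [set: R] w' by exact: measurable_positive_weight.
have wi : dyadic_integrable w'.
  by apply: positive_weight_dyadic => //; exact: locally_integrable_dyadic.
have si : dyadic_integrable s by case: (A2d_avg (0, 0) ww Ay).
have bi := locally_integrable_dyadic lb.
set A := fine (A2d_char w); set N := fine (BMOd_norm b).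
have wsA I : avg w' I * avg s I <= A by case: (A2d_avg I ww Ay).
have A0 : 0 <= A.
  by apply: le_trans (wsA (0, 0)); rewrite mulr_ge0 // avg_ge0 // => x;
    rewrite ?invr_ge0 ltW.
have bN I : avg (fun x => `|b x - avg b I|) I <= N by exact: BMOd_avg.
have N0 : 0 <= N by apply: le_trans (bN (0, 0)); exact: avg_ge0.
pose I0 : dyadic := (0, 0).
have AE : A2d_char w = A%:E.
  rewrite fineK // ge0_fin_numE //.
  apply: (@le_trans _ _ (eavg w I0 * eavg (fun x => ((w x)^-1)%R) I0)%E).
    rewrite eavg_positive_weightV // eavg_positive_weight // !eavgE //.
    by rewrite -EFinM lee_fin mulr_ge0 // avg_ge0 // => x; rewrite ?invr_ge0 ltW.
  by apply: ereal_sup_ubound; exists I0.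
have NE : BMOd_norm b = N%:E.
  rewrite fineK // ge0_fin_numE //.
  apply: (@le_trans _ _ (eavg (fun x => `|b x - avg b I0|) I0)).
    by rewrite mule_ge0 ?lee_fin ?invr_ge0 ?(ltW (dyadic_len_gt0 _ _)) // integral_ge0.
  by apply: ereal_sup_ubound; exists I0.
have C0 : 0 <= C by lra.
(* The stopping rule divides by [B], while the norm [N] of [b] may be 0; the bound is proved for
   [B > 0] and used with [B] slightly above [N]. *)
have main (B : R) : 0 < B -> N <= B ->
    (wopnorm w (paraproduct_adj b \o @dyadic_shift R) +
     wopnorm w (@dyadic_shift R \o paraproduct b) <= (24 * C * A * B)%:E)%E.
  move=> B0 NB; have bB I := le_trans (bN I) NB.
  have -> : 24 * C * A * B =
    2 * (2 * (4 * C * A * B)) + 2 * (4 * C * A * B) by ring.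
  rewrite EFinD; apply: leeD; apply: ge_ereal_sup => _ [f [/Lfun_sqint sf fw] <-] /=.
    rewrite wnorm_positive_weight //; last exact: (sqint_L2_series _).1.
    move: fw; rewrite wnorm_positive_weight //; last by case: sf.
    move=> /(wnorm_le1_integrable mw' w0 sf.1)[fwi fw1].
    exact: (adj_shift_bound mw' wi si bi w0 sw wsA bB B0 C1 sf fwi fw1).
  rewrite wnorm_positive_weight //; last exact: (sqint_L2_series _).1.
  move: fw; rewrite wnorm_positive_weight //; last by case: sf.
  move=> /(wnorm_le1_integrable mw' w0 sf.1)[fwi fw1].
  exact: (shift_paraproduct_bound mw' wi si bi w0 sw wsA bB B0 C1 sf fwi fw1).
rewrite AE NE -!EFinM; apply/lee_addgt0Pr => e e0.
have K0 : 0 < 24 * C * A + 1 by rewrite ltr_wpDl // !mulr_ge0.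
have d0 : 0 < e / (24 * C * A + 1) by rewrite divr_gt0.
apply: (le_trans (main (N + e / (24 * C * A + 1)) _ _)).
- by rewrite ltr_wpDl.
- by rewrite lerDl ltW.
rewrite -EFinD lee_fin mulrDr lerD2l mulrCA ler_piMr ?(ltW e0) //.
by rewrite ler_pdivrMr // mul1r lerDl.
Qed.
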